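(* Let $p\ge1$ and let $(W,\psi)\in\mathcal{ED}(p)$. For every $(g,G_1,G_2)\in SD_{2,p}(\Omega)$, $$I_{2,p}(g,G_1,G_2)=\widetilde I_{2,p}(g,G_1,G_2),$$ where $$I_{2,p}(g,G_1,G_2):=\inf\Big\{\liminf_{n_1}\liminf_{n_2}E(u_{n_1,n_2}):(u_{n_1,n_2})\subset SBV(\Omega;\mathbb{R}^d),\ u_{n_1,n_2}\stackrel{*}{\rightharpoonup}_H(g,G_1,G_2)\Big\}$$ and $$\widetilde I_{2,p}(g,G_1,G_2):=\inf\Big\{\liminf_{n_1}I_{1,p}(\gamma_{n_1},\Gamma_{n_1}):\big((\gamma_{n_1},\Gamma_{n_1})\big)\subset SD_{1,p}(\Omega),\ \gamma_{n_1}\stackrel{*}{\rightharpoonup}_H(g,G_1),\ \Gamma_{n_1}\stackrel{*}{\rightharpoonup}G_2\text{ in }\mathcal{M}(\Omega;\mathbb{R}^{d\times N})\Big\}.$$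
   Context: $\Omega\subset\mathbb{R}^N$ is a bounded, connected open set with Lipschitz boundary; $\mathbb{S}^{N-1}$ is the unit sphere. For $u\in SBV$, $\nabla u$ is the density of the absolutely continuous part of $Du$, $S_u$ the jump set, $[u]$ the jump, $\nu_u$ the normal. $\mathcal{M}$ denotes matrix-valued Radon measures ($L^1$ functions identified with measures). $SD_{1,p}(\Omega):=SBV(\Omega;\mathbb{R}^d)\times L^p(\Omega;\mathbb{R}^{d\times N})$ and $SD_{2,p}(\Omega):=SBV(\Omega;\mathbb{R}^d)\times L^1(\Omega;\mathbb{R}^{d\times N})\times L^p(\Omega;\mathbb{R}^{d\times N})$. Class $\mathcal{ED}(q)$, $q\ge1$: pairs $(W,\psi)$ with $W\colon\Omega\times\mathbb{R}^{d\times N}\to[0,+\infty)$ and $\psi\colon\Omega\times\mathbb{R}^d\times\mathbb{S}^{N-1}\to[0,+\infty)$ such that (1) $W$ is Carath\'eodory (measurable in $x$, continuous in $A$); (2) there is $C_W>0$ with $|W(x,A_1)-W(x,A_2)|\le C_W|A_1-A_2|(1+|A_1|^{q-1}+|A_2|^{q-1})$ for a.e. $x\in\Omega$ and all $A_1,A_2$; (3) there is $A_0\in\mathbb{R}^{d\times N}$ with $W(\cdot,A_0)\in L^\infty(\Omega)$; (4) there is $c_W>0$ with $W(x,A)\ge c_W|A|^q-\frac1{c_W}$ for a.e. $x\in\Omega$ and all $A$; (5) $\psi$ is continuous in all its variables; (6) $\psi(x,\lambda,\nu)=\psi(x,-\lambda,-\nu)$ for all $x,\lambda,\nu$; (7)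 there are $c_\psi,C_\psi>0$ with $c_\psi|\lambda|\le\psi(x,\lambda,\nu)\le C_\psi|\lambda|$ for all $x,\lambda,\nu$; (8) $\psi(x,t\lambda,\nu)=t\psi(x,\lambda,\nu)$ for all $x,\lambda,\nu$ and $t>0$; (9) $\psi(x,\lambda_1+\lambda_2,\nu)\le\psi(x,\lambda_1,\nu)+\psi(x,\lambda_2,\nu)$ for all $x,\lambda_1,\lambda_2,\nu$; (10) there is a continuous $\omega_\psi\colon[0,+\infty)\to[0,+\infty)$ with $\omega_\psi(s)\to0$ as $s\to0^+$ and $|\psi(x,\lambda,\nu)-\psi(x_0,\lambda,\nu)|\le\omega_\psi(|x-x_0|)|\lambda|$ for all $x_0,x,\lambda,\nu$. Initial energy: for $u\in SBV(\Omega;\mathbb{R}^d)$, $E(u):=\int_\Omega W(x,\nabla u)\,dx+\int_{\Omega\cap S_u}\psi(x,[u],\nu_u)\,d\mathcal{H}^{N-1}$. Convergences: $u_n\stackrel{*}{\rightharpoonup}_H(g,G)$ (single index) means $u_n\to g$ in $L^1(\Omega;\mathbb{R}^d)$ and $\nabla u_n\stackrel{*}{\rightharpoonup}G$ in $\mathcal{M}(\Omega;\mathbb{R}^{d\times N})$. $u_{n_1,n_2}\stackrel{*}{\rightharpoonup}_H(g,G_1,G_2)$ means: (i) $\lim_{n_1}\lim_{n_2}u_{n_1,n_2}=g$ with iterated limits in $L^1(\Omega;\mathbb{R}^d)$; (ii) there is $(g_{n_1})\subset SBV(\Omega;\mathbb{R}^d)$ with $\lim_{n_2}u_{n_1,n_2}=g_{n_1}$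 in $L^1$ for every $n_1$ and $\nabla g_{n_1}\stackrel{*}{\rightharpoonup}G_1$ in $\mathcal{M}$; (iii) $\lim_{n_1}\lim_{n_2}\nabla u_{n_1,n_2}=G_2$ with iterated limits weak* in $\mathcal{M}$. Two-level relaxed energy: for $(\gamma,\Gamma)\in SD_{1,p}(\Omega)$, $I_{1,p}(\gamma,\Gamma):=\inf\{\liminf_nE(u_n):u_n\in SBV(\Omega;\mathbb{R}^d),\ u_n\stackrel{*}{\rightharpoonup}_H(\gamma,\Gamma)\}$.
   Formalization: For p = 1, admissible sequences in I_{2,p} must also have inner weak* limits lim_{n2} ∇u_{n1,n2} in L^1 for every n1; with singular inner limits the equality fails (W=|A|, ψ=100|λ|, g(x)=x, G1=0, G2=1 on (0,1)). For p > 1 the statement is unchanged. *)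

(* Defs.v *)
From HB Require Import structures.
From mathcomp Require Import all_boot all_order all_algebra.
From mathcomp Require Import all_classical all_reals all_analysis.
Import Order.TTheory GRing.Theory Num.Theory.
Import numFieldNormedType.Exports.

Set Implicit Arguments.
Unset Strict Implicit.
Unset Printing Implicit Defensive.

Local Open Scope classical_set_scope.
Local Open Scope ring_scope.

(* The library norm on matrices is the sup norm (it induces the usual
   topology); |.| in the energies, in balls and in diameters is Euclidean. *)
Definition enorm {R : realType} {m n : nat} (A : 'M[R]_(m, n)) : R :=
  Num.sqrt (\sum_i \sum_j A i j ^+ 2).

Definition dot {R : realType} {n : nat} (x y : 'rV[R]_n) : R :=
  \sum_j x ord0 j * y ord0 j.

Definition usphere {R : realType} {n : nat} : set 'rV[R]_n :=
  [set nu | enorm nu = 1].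

(* ** Lebesgue and Hausdorff measures on R^n
   Both are the restriction of an outer measure to its Caratheodory sets.  The
   outer measures are obtained from a gauge defined on all sets; a gauge equal
   to +oo excludes a set from the admissible coverings. *)
Definition gauge_outer {R : realType} {T : pointedType}
    (rho : set T -> \bar R) (X : set T) : \bar R :=
  @mu_ext _ (g_sigma_algebraType [set: set T]) R rho X.

Definition box {R : realType} {n : nat} (a b : 'rV[R]_n) : set 'rV[R]_n :=
  [set x | forall i, a ord0 i <= x ord0 i <= b ord0 i].

Definition box_volume (R : realType) (n : nat) (C : set 'rV[R]_n) : \bar R :=
  ereal_inf [set v | (C = set0 /\ v = 0%E) \/
    exists a b : 'rV[R]_n, [/\ forall i, a ord0 i <= b ord0 i, C = box a b &
      v = (\prod_i (b ord0 i - a ord0 i))%:E]].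

Definition leb_outer (R : realType) (n : nat) : set 'rV[R]_n -> \bar R :=
  gauge_outer (@box_volume R n).

Definition diameter {R : realType} {n : nat} (C : set 'rV[R]_n) : \bar R :=
  ereal_sup [set (enorm (x - y))%:E | x in C & y in C].

Definition unit_ball (R : realType) (s : nat) : set 'rV[R]_s :=
  [set x | enorm x <= 1].

(* omega_s (diam C / 2)^s, where omega_s is the volume of the Euclidean unit
   ball of R^s, if diam C <= delta.  For s = 0 this is 1 on nonempty sets, so
   that the 0-dimensional Hausdorff measure is the counting measure. *)
Definition hausdorff_gauge (R : realType) (n s : nat) (delta : R)
    (C : set 'rV[R]_n) : \bar R :=
  if C == set0 then 0%E
  else if (diameter C <= delta%:E)%E then
    (leb_outer (@unit_ball R s) * ((2^-1)%:E * diameter C) ^+ s)%E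
  else +oo%E.

Definition hausdorff_outer (R : realType) (n s : nat) (A : set 'rV[R]_n) :
    \bar R :=
  ereal_sup [set gauge_outer (@hausdorff_gauge R n s delta) A |
    delta in [set delta : R | 0 < delta]].

Section outer_measures.
Context (R : realType).

Lemma box_volume0 n : @box_volume R n set0 = 0%E.
Proof.
apply/eqP; rewrite eq_le; apply/andP; split.
  by apply: ereal_inf_lbound; left.
apply: le_ereal_inf_tmp => _ [[_ ->//]|[a [b [ab _ ->]]]].
by rewrite lee_fin prodr_ge0// => i _; rewrite subr_ge0.
Qed.

Lemma box_volume_ge0 n (C : set 'rV[R]_n) : (0 <= box_volume C)%E.
Proof.
apply: le_ereal_inf_tmp => _ [[_ ->//]|[a [b [ab _ ->]]]].
by rewrite lee_fin prodr_ge0// => i _; rewrite subr_ge0.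
Qed.

HB.instance Definition _ n := isOuterMeasure.Build R 'rV[R]_n (@leb_outer R n)
  (@mu_ext0 _ (g_sigma_algebraType [set: set 'rV[R]_n]) R _
     (box_volume0 n) (@box_volume_ge0 n))
  (@mu_ext_ge0 _ (g_sigma_algebraType [set: set 'rV[R]_n]) R _
     (@box_volume_ge0 n))
  (@le_mu_ext _ (g_sigma_algebraType [set: set 'rV[R]_n]) R _)
  (@mu_ext_sigma_subadditive _ (g_sigma_algebraType [set: set 'rV[R]_n]) R _
     (@box_volume_ge0 n)).

Lemma diameter_ge0 n (C : set 'rV[R]_n) : C !=set0 -> (0 <= diameter C)%E.
Proof.
move=> [x Cx]; apply: (@le_trans _ _ (enorm (x - x))%:E).
  by rewrite lee_fin sqrtr_ge0.
by apply: ereal_sup_ubound; exists x => //; exists x.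
Qed.

Lemma hausdorff_gauge0 n s (delta : R) : @hausdorff_gauge R n s delta set0 = 0%E.
Proof. by rewrite /hausdorff_gauge eqxx. Qed.

Lemma hausdorff_gauge_ge0 n s (delta : R) (C : set 'rV[R]_n) :
  (0 <= hausdorff_gauge s delta C)%E.
Proof.
rewrite /hausdorff_gauge; case: eqVneq => // /set0P C0.
case: ifPn => // _; apply: mule_ge0; first exact: outer_measure_ge0.
by apply: expe_ge0; apply: mule_ge0; [rewrite lee_fin|exact: diameter_ge0].
Qed.

Let H n s (delta : R) : set 'rV[R]_n -> \bar R :=
  gauge_outer (@hausdorff_gauge R n s delta).

Let H_ge0 n s delta A : (0 <= @H n s delta A)%E.
Proof. exact/mu_ext_ge0/hausdorff_gauge_ge0. Qed.

Let H_le n s delta A : 0 < delta -> (@H n s delta A <= hausdorff_outer s A)%E.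
Proof. by move=> d0; apply: ereal_sup_ubound; exists delta. Qed.

Lemma hausdorff_outer_ge0 n s (A : set 'rV[R]_n) : (0 <= hausdorff_outer s A)%E.
Proof. apply: (@le_trans _ _ (H s 1 A)); [exact: H_ge0|exact: H_le]. Qed.

Lemma hausdorff_outer0 n s : hausdorff_outer s (set0 : set 'rV[R]_n) = 0%E.
Proof.
apply/eqP; rewrite eq_le hausdorff_outer_ge0 andbT.
apply: ge_ereal_sup => _ [delta d0 <-].
by rewrite /gauge_outer mu_ext0//;
  [exact: hausdorff_gauge0|exact: hausdorff_gauge_ge0].
Qed.

Lemma le_hausdorff_outer n s :
  {homo @hausdorff_outer R n s : A B / A `<=` B >-> (A <= B)%E}.
Proof.
move=> A B AB; apply: ge_ereal_sup => _ [delta d0 <-].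
apply: (@le_trans _ _ (H s delta B)); [exact: le_mu_ext|exact: H_le].
Qed.

Lemma hausdorff_outer_sigma_subadditive n s :
  sigma_subadditive (@hausdorff_outer R n s).
Proof.
move=> F; apply: ge_ereal_sup => _ [delta d0 <-].
apply: le_trans (mu_ext_sigma_subadditive _ _) _.
  exact: hausdorff_gauge_ge0.
apply: lee_nneseries => [k _ _|k _]; first exact: H_ge0.
exact: H_le.
Qed.

HB.instance Definition _ n s :=
  isOuterMeasure.Build R 'rV[R]_n (@hausdorff_outer R n s)
    (hausdorff_outer0 n s) (@hausdorff_outer_ge0 n s)
    (@le_hausdorff_outer n s) (@hausdorff_outer_sigma_subadditive n s).

End outer_measures.

(* R^n with the Lebesgue, H^s-measurable and Borel sigma-algebras. *)
Definition lebT (R : realType) (n : nat) := caratheodory_type (@leb_outer R n).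
Definition leb (R : realType) (n : nat) : set (lebT R n) -> \bar R :=
  @leb_outer R n.
HB.instance Definition _ (R : realType) (n : nat) :=
  isMeasure.Build _ (lebT R n) R (@leb R n)
    (caratheodory_measure0 (@leb_outer R n))
    (caratheodory_measure_ge0 (mu := @leb_outer R n))
    (caratheodory_measure_sigma_additive (mu := @leb_outer R n)).

Definition hausT (R : realType) (n s : nat) :=
  caratheodory_type (@hausdorff_outer R n s).
Definition haus (R : realType) (n s : nat) : set (hausT R n s) -> \bar R :=
  @hausdorff_outer R n s.
HB.instance Definition _ (R : realType) (n s : nat) :=
  isMeasure.Build _ (hausT R n s) R (@haus R n s)
    (caratheodory_measure0 (@hausdorff_outer R n s))
    (caratheodory_measure_ge0 (mu := @hausdorff_outer R n s))
    (caratheodory_measure_sigma_additive (mu := @hausdorff_outer R n s)).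

Arguments leb : clear implicits.
Arguments haus : clear implicits.

Definition borT (R : realType) (n : nat) :=
  g_sigma_algebraType (@open 'rV[R]_n).

(* ** Integral against a signed measure, through its Jordan decomposition
   (the choice of the Hahn decomposition is immaterial). *)
Section charge_integral.
Context d (T : measurableType d) (R : realType)
  (nu : {charge set T -> \bar R}).

Lemma hahn_exists : exists PN, hahn_decomposition nu PN.1 PN.2.
Proof. by have [P [N PN]] := Hahn_decomposition nu; exists (P, N). Qed.

Definition charge_integral (D : set T) (f : T -> R) : R :=
  let nuPN := svalP (cid hahn_exists) in
  Rintegral (jordan_pos nuPN) D f - Rintegral (jordan_neg nuPN) D f.
End charge_integral.

Section domain.
Context {R : realType} {N : nat}.
Notation X := 'rV[R]_N.

(* Near each boundary point, in suitable Cartesian coordinates whose last axis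
   is e, the domain is the region above the graph of a Lipschitz function of
   the coordinates orthogonal to e; such a function is encoded as a function f
   on R^N that is invariant under translations along e. *)
Definition lipschitz_boundary (Omega : set X) : Prop :=
  forall x0, closure Omega x0 -> ~ interior Omega x0 ->
  exists (r L : R) (e : X) (f : X -> R),
  [/\ 0 < r, enorm e = 1,
      forall y z, `|f y - f z| <= L * enorm (y - z),
      forall y t, f (y + t *: e) = f y &
      forall y, enorm (y - x0) < r -> (Omega y <-> f y < dot y e)].

(* ** L^p and L^1 convergence *)
Definition Lp {m n : nat} (Omega : set X) (p : R) (G : X -> 'M[R]_(m, n)) :
    Prop :=
  (forall i j, measurable_fun (Omega : set (lebT R N)) (fun x => G x i j)) /\
  (\int[leb R N]_(x in Omega) (enorm (G x) `^ p)%:E < +oo)%E.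

Definition cvg_L1 {m n : nat} (Omega : set X) (u : nat -> X -> 'M[R]_(m, n))
    (g : X -> 'M[R]_(m, n)) : Prop :=
  (fun k => \int[leb R N]_(x in Omega) (enorm (u k x - g x))%:E)%E @ \oo
    --> 0%E.

(* ** Matrix-valued Radon measures on Omega
   They are represented by finite signed Borel measures on R^N, of which only
   the restriction to Omega is ever used. *)
Definition mxmeasure (m n : nat) := 'I_m -> 'I_n -> {charge set (borT R N) -> \bar R}.

Definition C0 (Omega : set X) (phi : X -> R) : Prop :=
  {within Omega, continuous phi} /\
  forall e : R, 0 < e -> exists K : set X,
    [/\ compact K, K `<=` Omega & forall x, Omega x -> ~ K x -> `|phi x| < e].

(* Elements of M(Omega) act on C0(Omega); L^1 functions are measures through
   their density. *)
Definition pair_fun {m n : nat} (Omega : set X) (G : X -> 'M[R]_(m, n))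
    (phi : X -> R) : 'M[R]_(m, n) :=
  \matrix_(i, j) Rintegral (leb R N) Omega (fun x => phi x * G x i j).

Definition pair_mes {m n : nat} (Omega : set X) (mu : mxmeasure m n)
    (phi : X -> R) : 'M[R]_(m, n) :=
  \matrix_(i, j) charge_integral (mu i j) Omega phi.

Definition cvg_wstar {m n : nat} (Omega : set X)
    (T : nat -> (X -> R) -> 'M[R]_(m, n)) (T0 : (X -> R) -> 'M[R]_(m, n)) :
    Prop :=
  forall phi, C0 Omega phi -> (fun k => T k phi) @ \oo --> T0 phi.

(* ** Functions of bounded variation *)
Section SBV.
Context {d : nat}.
Notation Y := 'rV[R]_d.
Notation M := 'M[R]_(d, N).

(* a and b are the one-sided approximate limits of u at x, on the sides of nu
   and of - nu respectively. *)
Definition half_ball (x nu : X) (r : R) : set X :=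
  [set y | enorm (y - x) < r /\ 0 < dot (y - x) nu].

Definition is_jump (u : X -> Y) (x : X) (t : Y * Y * X) : Prop :=
  let: (a, b, nu) := t in
  [/\ a <> b, enorm nu = 1,
      (fun r : R => ((r ^- N)%:E *
         \int[leb R N]_(y in half_ball x nu r) (enorm (u y - a))%:E)%E)
        @ 0^'+ --> 0%E &
      (fun r : R => ((r ^- N)%:E *
         \int[leb R N]_(y in half_ball x (- nu) r) (enorm (u y - b))%:E)%E)
        @ 0^'+ --> 0%E].

Definition jump_set (Omega : set X) (u : X -> Y) : set X :=
  [set x | Omega x /\ exists t, is_jump u x t].

(* The triple (u^+, u^-, nu_u) is unique up to the change to
   (u^-, u^+, - nu_u), under which [u] (x) nu_u and psi(x, [u], nu_u) are
   invariant. *)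
Definition jump_triple (u : X -> Y) (x : X) : Y * Y * X :=
  xget (0, 0, 0) [set t | is_jump u x t].
Definition jump (u : X -> Y) (x : X) : Y :=
  (jump_triple u x).1.1 - (jump_triple u x).1.2.
Definition jump_normal (u : X -> Y) (x : X) : X := (jump_triple u x).2.

Definition Cc1 (Omega : set X) (phi : X -> R) : Prop :=
  [/\ forall x, differentiable phi x,
      forall j : 'I_N,
        continuous (fun x => derive phi x (delta_mx ord0 j : X)) &
      exists K : set X,
        [/\ compact K, K `<=` Omega & forall x, ~ K x -> phi x = 0]].

Definition is_distr_derivative (Omega : set X) (u : X -> Y)
    (Du : mxmeasure d N) : Prop :=
  forall phi, Cc1 Omega phi -> forall i j,
    Rintegral (leb R N) Omega
      (fun x => u x ord0 i * derive phi x (delta_mx ord0 j : X))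
    = - charge_integral (Du i j) Omega phi.

(* u is in SBV(Omega; R^d) and A is the density of the absolutely continuous
   part of Du, i.e. Du = A L^N + [u] (x) nu_u H^{N-1} |_ S_u in Omega. *)
Definition sbv_decomposition (Omega : set X) (u : X -> Y) (A : X -> M) :
    Prop :=
  [/\ Lp Omega 1 u, Lp Omega 1 A,
      forall i j, (haus R N N.-1).-integrable (jump_set Omega u)
        (fun x => (jump u x ord0 i * jump_normal u x ord0 j)%:E) &
      exists2 Du : mxmeasure d N, is_distr_derivative Omega u Du &
        forall (B : set (borT R N)), measurable B -> B `<=` Omega ->
        forall i j, Du i j B =
          (\int[leb R N]_(x in B) (A x i j)%:E +
           \int[haus R N N.-1]_(x in B `&` jump_set Omega u)
             (jump u x ord0 i * jump_normal u x ord0 j)%:E)%E].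

Definition SBV (Omega : set X) (u : X -> Y) : Prop :=
  exists A, sbv_decomposition Omega u A.

Definition grad (Omega : set X) (u : X -> Y) : X -> M :=
  xget (fun=> 0) [set A | sbv_decomposition Omega u A].

(* ** Structured deformations and energies *)
Definition SD1 (Omega : set X) (p : R) (gamma : X -> Y) (Gamma : X -> M) :
    Prop :=
  SBV Omega gamma /\ Lp Omega p Gamma.

Definition SD2 (Omega : set X) (p : R) (g : X -> Y) (G1 G2 : X -> M) : Prop :=
  [/\ SBV Omega g, Lp Omega 1 G1 & Lp Omega p G2].

Record ED (Omega : set X) (q : R) (W : X -> M -> R) (psi : X -> Y -> X -> R) :
    Prop := {
  ED_W_ge0 : forall x A, Omega x -> 0 <= W x A;
  ED_psi_ge0 : forall x lambda nu, Omega x -> usphere nu ->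
    0 <= psi x lambda nu;
  ED_W_measurable : forall A,
    measurable_fun (Omega : set (lebT R N)) (fun x => W x A);
  ED_W_continuous : {ae leb R N, forall x, Omega x -> continuous (W x)};
  ED_W_lipschitz : exists2 C : R, 0 < C &
    {ae leb R N, forall x, Omega x -> forall A1 A2,
      `|W x A1 - W x A2| <=
        C * enorm (A1 - A2) *
          (1 + enorm A1 `^ (q - 1) + enorm A2 `^ (q - 1))};
  ED_W_bounded : exists A0 : M, exists C : R,
    {ae leb R N, forall x, Omega x -> `|W x A0| <= C};
  ED_W_coercive : exists2 c : R, 0 < c &
    {ae leb R N, forall x, Omega x -> forall A,
      c * enorm A `^ q - c^-1 <= W x A};
  ED_psi_continuous :
    {within [set z : X * Y * X | Omega z.1.1 /\ usphere z.2],
      continuous (fun z : X * Y * X => psi z.1.1 z.1.2 z.2)};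
  ED_psi_even : forall x lambda nu, Omega x -> usphere nu ->
    psi x lambda nu = psi x (- lambda) (- nu);
  ED_psi_growth : exists c C : R, [/\ 0 < c, 0 < C &
    forall x lambda nu, Omega x -> usphere nu ->
      c * enorm lambda <= psi x lambda nu <= C * enorm lambda];
  ED_psi_homogeneous : forall x lambda nu (t : R), Omega x ->
    usphere nu -> 0 < t -> psi x (t *: lambda) nu = t * psi x lambda nu;
  ED_psi_subadditive : forall x lambda1 lambda2 nu, Omega x ->
    usphere nu ->
    psi x (lambda1 + lambda2) nu <= psi x lambda1 nu + psi x lambda2 nu;
  ED_psi_modulus : exists omega : R -> R,
    [/\ {within `[0, +oo[, continuous omega},
        forall s, 0 <= s -> 0 <= omega s,
        omega s @[s --> 0^'+] --> 0 &
        forall x0 x lambda nu, Omega x0 -> Omega x -> usphere nu ->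
          `|psi x lambda nu - psi x0 lambda nu|
            <= omega (enorm (x - x0)) * enorm lambda] }.

Section energies.
Variables (Omega : set X) (W : X -> M -> R) (psi : X -> Y -> X -> R).

Definition energy (u : X -> Y) : \bar R :=
  (\int[leb R N]_(x in Omega) (W x (grad Omega u x))%:E +
   \int[haus R N N.-1]_(x in jump_set Omega u)
     (psi x (jump u x) (jump_normal u x))%:E)%E.

Definition cvgH1 (u : nat -> X -> Y) (g : X -> Y) (G : X -> M) : Prop :=
  cvg_L1 Omega u g /\
  cvg_wstar Omega (fun k => pair_fun Omega (grad Omega (u k)))
    (pair_fun Omega G).

(* mu n1 is the inner weak* limit of the gradients, as n2 -> oo. *)
Definition cvgH2 (u : nat -> nat -> X -> Y) (g : X -> Y) (G1 G2 : X -> M)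
    (mu : nat -> mxmeasure d N) : Prop :=
  [/\ exists2 h : nat -> X -> Y,
        forall n1, Lp Omega 1 (h n1) /\ cvg_L1 Omega (u n1) (h n1) &
        cvg_L1 Omega h g,
      exists2 gn : nat -> X -> Y,
        forall n1, SBV Omega (gn n1) /\ cvg_L1 Omega (u n1) (gn n1) &
        cvg_wstar Omega (fun n1 => pair_fun Omega (grad Omega (gn n1)))
          (pair_fun Omega G1),
      forall n1, cvg_wstar Omega
        (fun n2 => pair_fun Omega (grad Omega (u n1 n2)))
        (pair_mes Omega (mu n1)) &
      cvg_wstar Omega (fun n1 => pair_mes Omega (mu n1))
        (pair_fun Omega G2)].

Definition is_L1_measure (mu : mxmeasure d N) : Prop :=
  exists2 Gamma : X -> M, Lp Omega 1 Gamma &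
    forall phi, C0 Omega phi -> pair_mes Omega mu phi = pair_fun Omega Gamma phi.

Definition I1 (gamma : X -> Y) (Gamma : X -> M) : \bar R :=
  ereal_inf [set limn_einf (fun n => energy (u n)) |
    u in [set u : nat -> X -> Y |
      (forall n, SBV Omega (u n)) /\ cvgH1 u gamma Gamma]].

(* For p > 1 the inner limits mu n1 are arbitrary Radon measures.  For p = 1
   they are L^1 functions, so that (lim_n2 u_(n1,n2), mu n1) can belong to
   SD_(1,1): with singular inner limits I2 = I2t fails.  Take N = d = 1,
   Omega = (0,1), W(A) = |A|, psi(lambda) = 100 |lambda|, g(x) = x, G1 = 0,
   G2 = 1, and for u_(n1,n2) the staircase with n1 steps whose jumps are
   replaced by ramps of width 1/n2: the energies are at most 1, whereas the
   other infimum is at least 100. *)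
Definition I2 (p : R) (g : X -> Y) (G1 G2 : X -> M) : \bar R :=
  ereal_inf
    [set limn_einf (fun n1 => limn_einf (fun n2 => energy (u n1 n2))) |
      u in [set u : nat -> nat -> X -> Y |
        (forall n1 n2, SBV Omega (u n1 n2)) /\
        exists2 mu : nat -> mxmeasure d N, cvgH2 u g G1 G2 mu &
          p = 1 -> forall n1, is_L1_measure (mu n1)]].

Definition I2t (p : R) (g : X -> Y) (G1 G2 : X -> M) : \bar R :=
  ereal_inf
    [set limn_einf (fun n => I1 (s.1 n) (s.2 n)) |
      s in [set s : (nat -> X -> Y) * (nat -> X -> M) |
        [/\ forall n, SD1 Omega p (s.1 n) (s.2 n),
            cvgH1 s.1 g G1 &
            cvg_wstar Omega (fun n => pair_fun Omega (s.2 n))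
              (pair_fun Omega G2)]]].

End energies.
End SBV.
End domain.

(* Main.v *)
From HB Require Import structures.
Require Import Defs.
From mathcomp Require Import all_boot all_order all_algebra.
From mathcomp Require Import all_classical all_reals all_analysis.
From mathcomp Require Import measurable_realfun zify ring lra.
Import Order.TTheory GRing.Theory Num.Theory.
Import numFieldNormedType.Exports.

Set Implicit Arguments.
Unset Strict Implicit.
Unset Printing Implicit Defensive.

Local Open Scope classical_set_scope.
Local Open Scope ring_scope.

(** Fix a real [K] above the iterated lower limit of the energies along an admissible
    sequence and keep only the outer indices whose inner value is below [K].
    From pairs [(gamma_n, Gamma_n)], nearly optimal sequences for
    [I1 gamma_n Gamma_n] form an admissible double sequence, whose inner weak*
    limits are the measures with density [Gamma_n].  Conversely, the inner
    limits of a double sequence are admissible pairs once the inner weak* limit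
    of the gradients is known to lie in [L^p]: this is assumed for [p = 1], and
    for [p > 1] the gradients are bounded in [L^p] along a subsequence, by
    coercivity, and a weak limit of a bounded sequence of [L^p] is in [L^p].
    The last fact is obtained without duality, from the strict convexity of
    [f |-> \int sqrt (1 + f^2)]. *)

(** * Weak limits of bounded sequences of L^p *)

(** The gap between the two infima is one of regularity: the inner limits of the gradients are a
    priori only measures, while [SD1] asks for a field in L^p. The bound by [K] is what gives access
    to coercivity, since a finite outer lower limit says nothing about the inner sequences that are
    dropped. The integrand sqrt (1 + t^2) has linear growth, so one functional serves every p > 1,
    and its midpoint gap is bounded below explicitly in terms of (a - b)^2. This bound degenerates
    for large arguments; there the L^p bound takes over with a factor M^(1-p), which tends to 0
    because p > 1. For p = 1 mass may concentrate and this control is lost. In the opposite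
    direction a field must be turned into a measure. Fields are Lebesgue measurable and measures
    live on Borel sets, whence densities pushed forward along a map between two measurable
    spaces. *)

Section sqrt1D.
Context {R : realType}.
Implicit Types a b t : R.

Definition sqrt1D t : R := Num.sqrt (1 + t ^+ 2).

Lemma sqrt1D_sqr t : sqrt1D t ^+ 2 = 1 + t ^+ 2.
Proof. by rewrite sqr_sqrtr// addr_ge0// sqr_ge0. Qed.

Lemma sqrt1D_ge1 t : 1 <= sqrt1D t.
Proof.
by rewrite -[leLHS]sqrtr1 ler_wsqrtr// lerDl sqr_ge0.
Qed.

Lemma sqrt1D_le t : sqrt1D t <= 1 + `|t|.
Proof.
rewrite -(@ler_pXn2r _ 2)// ?nnegrE ?addr_ge0// ?sqrtr_ge0//.
rewrite sqrt1D_sqr sqrrD expr1n -normrX (ger0_norm (sqr_ge0 _)).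
by rewrite -addrA lerD2l lerDr mulrn_wge0// mulr_ge0.
Qed.

(** Quantitative strict convexity. With A, B, M the values at a, b and the midpoint, and Y = A B - 1
    - a b, one has (A + B)^2 - 4 M^2 = 2 Y and Y (A B + 1 + a b) = (a - b)^2; the cofactors A + B +
    2 M and A B + 1 + a b are then bounded by powers of A + B. *)
Lemma sqrt1D_midpoint a b :
  (a - b) ^+ 2 * 2 <= (sqrt1D a + sqrt1D b) ^+ 3 *
     (sqrt1D a + sqrt1D b - sqrt1D ((a + b) / 2) * 2).
Proof.
have := sqrt1D_sqr a; have := sqrt1D_sqr b; have := sqrt1D_sqr ((a + b) / 2).
have := sqrt1D_ge1 a; have := sqrt1D_ge1 b; have := sqrt1D_ge1 ((a + b) / 2).
move: (sqrt1D a) (sqrt1D b) (sqrt1D ((a + b) / 2)) => A B M M1 B1 A1 Me Be Ae.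
pose Y := A * B - 1 - a * b.
have e1 : (A + B) ^+ 2 - (M * 2) ^+ 2 = Y * 2.
  by rewrite sqrrD exprMn Me Ae Be /Y; field.
have e2 : Y * (A * B + 1 + a * b) = (a - b) ^+ 2.
  transitivity (A ^+ 2 * B ^+ 2 - (1 + a * b) ^+ 2); first by rewrite /Y; ring.
  by rewrite Ae Be; ring.
(* Cauchy-Schwarz for the vectors (1, a) and (1, b). *)
have AB1 : `|1 + a * b| <= A * B.
  rewrite -(@ler_pXn2r _ 2)// ?nnegrE ?mulr_ge0//; try lra.
  rewrite -normrX ger0_norm ?sqr_ge0// exprMn Ae Be -subr_ge0.
  by rewrite (_ : _ - _ = (a - b) ^+ 2) ?sqr_ge0//; ring.
have Y0 : 0 <= Y.
  by rewrite /Y -addrA -opprD subr_ge0 (le_trans (ler_norm _)).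
have M2 : M * 2 <= A + B.
  rewrite -(@ler_pXn2r _ 2)// ?nnegrE; [|lra|lra].
  by rewrite -subr_ge0 e1 mulr_ge0.
have Dl : Y * 2 <= (A + B - M * 2) * ((A + B) * 2).
  rewrite -e1 subr_sqr ler_wpM2l//; lra.
have l1 : A * B + 1 + a * b <= (A + B) ^+ 2 / 2.
  have := ler_norm (1 + a * b); have := sqr_ge0 (A - B); nra.
apply: (@le_trans _ _ (Y * 2 * ((A + B) ^+ 2 / 2))).
  rewrite -e2 mulrAC ler_wpM2l// mulr_ge0//.
have S0 : 0 <= (A + B) ^+ 2 / 2 by rewrite divr_ge0// sqr_ge0.
apply: le_trans (ler_wpM2r S0 Dl) _.
by rewrite le_eqVlt; apply/orP; left; apply/eqP; field.
Qed.

Lemma sqrt1D_gap_ge0 a b : 0 <= sqrt1D a + sqrt1D b - sqrt1D ((a + b) / 2) * 2.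
Proof.
have := sqrt1D_midpoint a b; have := sqrt1D_ge1 a; have := sqrt1D_ge1 b.
have := sqr_ge0 (a - b).
set D := (_ + _ - _ * 2)%R; move: D (sqrt1D a) (sqrt1D b) => D A B d0 B1 A1 h.
have S0 : 0 < (A + B) ^+ 3 by rewrite exprn_gt0//; lra.
by rewrite -(pmulr_rge0 _ S0) (le_trans _ h)// mulr_ge0.
Qed.

(* Where [|a|, |b| <= M], use [sqrt1D_midpoint] and [s <= e + s^2 / e]; where
   [t = |a|] or [|b|] exceeds [M], use [t <= M^(1-p) t^p]. *)
Lemma dist_le_gap (p M e : R) a b : 1 < p -> 1 <= M -> 0 < e ->
  `|a - b| <= e +
    (M ^+ 3 * 32 / e) * (sqrt1D a + sqrt1D b - sqrt1D ((a + b) / 2) * 2) +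
    M `^ (1 - p) * 2 * (`|a| `^ p + `|b| `^ p).
Proof.
move=> p1 M1 e0.
have D0 := sqrt1D_gap_ge0 a b; have := sqrt1D_midpoint a b.
have := sqrt1D_le a; have := sqrt1D_le b.
have := sqrt1D_ge1 a; have := sqrt1D_ge1 b.
move: D0; set D := (_ + _ - _ * 2)%R; move: D => D.
move: (sqrt1D a) (sqrt1D b) => A B D0 B1 A1 BM AM h.
have M0 : 0 < M by lra.
have K0 : 0 <= M ^+ 3 * 32 / e * D.
  by rewrite mulr_ge0// divr_ge0 ?mulr_ge0 ?exprn_ge0//; lra.
have big t : M < t -> t <= M `^ (1 - p) * t `^ p.
  move=> Mt; have t0 : 0 < t by lra.
  rewrite -(mulr_powRB1 (ltW t0)); last lra.
  rewrite -(opprB p).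
  rewrite mulrCA ler_peMr ?(ltW t0)// powRN mulrC ler_pdivlMr ?powR_gt0// mul1r.
  by rewrite ge0_ler_powR ?nnegrE; lra.
have P0 x : 0 <= M `^ (1 - p) * x `^ p by rewrite mulr_ge0// powR_ge0.
have ab : `|a - b| <= `|a| + `|b| by rewrite ler_normB.
have := P0 `|a|; have := P0 `|b|.
have [Ma|aM] := ltP M `|a|; have [Mb|bM] := ltP M `|b|.
- have := big _ Ma; have := big _ Mb; lra.
- have := big _ Ma; lra.
- have := big _ Mb; lra.
move=> Pb Pa; suff : `|a - b| <= e + M ^+ 3 * 32 / e * D by lra.
have [?|ex] := leP `|a - b| e; first by lra.
suff : `|a - b| <= M ^+ 3 * 32 / e * D by lra.
rewrite mulrAC ler_pdivlMr// (@le_trans _ _ (`|a - b| * `|a - b|))//.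
  by rewrite ler_wpM2l// ltW.
rewrite -expr2 -normrX ger0_norm ?sqr_ge0//.
have S3 : (A + B) ^+ 3 <= (M * 4) ^+ 3 by rewrite lerXn2r ?nnegrE//; lra.
have := ler_wpM2r D0 S3; rewrite exprMn; lra.
Qed.

Lemma midpoint_powR (p : R) a b : 1 <= p ->
  `|(a + b) / 2| `^ p <= (`|a| `^ p + `|b| `^ p) / 2.
Proof.
move=> p1; have p0 : 0 <= p by lra.
rewrite (@le_trans _ _ ((2^-1 * `|a| + 2^-1 * `|b|) `^ p))//.
  rewrite ge0_ler_powR ?nnegrE ?addr_ge0 ?mulr_ge0 ?invr_ge0//.
  rewrite normrM (ger0_norm (_ : 0 <= 2^-1)) ?invr_ge0// -mulrDr mulrC.
  by rewrite ler_wpM2l ?invr_ge0// ler_normD.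
rewrite [leRHS](_ : _ = 2^-1 * `|a| `^ p + 2^-1 * `|b| `^ p); last by field.
rewrite {2 4}(_ : 2^-1 = 1 - 2^-1); last by field.
by apply: (convex_powR p1 (Itv01 _ _)) => //=;
  rewrite ?inE/= ?in_itv/= ?normr_ge0// ?invr_ge0// invf_le1 ?ler1n.
Qed.
End sqrt1D.

(** * Midpoint averages in an L^p ball *)

Lemma le1_powR {R : realType} (p t : R) : 1 <= p -> 0 <= t -> t <= 1 + t `^ p.
Proof.
move=> p1 t0; have [t1|t1] := leP t 1; first by have := powR_ge0 t p; lra.
by rewrite (@le_trans _ _ (t `^ p)) ?lerDr// le1r_powR// ltW.
Qed.

(** Midpoints are enough because the convexity estimate compares two functions with their average
    only; bounds on the hull then follow by induction. *)
Inductive midpoint_hull {R : realType} {T : Type} (A : set (T -> R)) :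
    set (T -> R) :=
| midpoint_hull_in f : A f -> midpoint_hull A f
| midpoint_hull_mid f g : midpoint_hull A f -> midpoint_hull A g ->
    midpoint_hull A (fun x => (f x + g x) / 2).

Lemma midpoint_hullS {R : realType} {T : Type} (A B : set (T -> R)) :
  A `<=` B -> midpoint_hull A `<=` midpoint_hull B.
Proof.
move=> AB f; elim=> [g /AB|g h _ gB _ hB]; first exact: midpoint_hull_in.
exact: midpoint_hull_mid.
Qed.

Section weak_limit.
Context d (T : measurableType d) (R : realType).
Variables (mu : {measure set T -> \bar R}) (D : set T).
Hypotheses (mD : measurable D) (Dfin : (mu D < +oo)%E).
Variables (p C : R) (p1 : 1 < p).

(** [C] bounds the integral of |f|^p, so it is the p-th power of a radius. *)
Definition Lp_ball : set (T -> R) := [set f : T -> R | measurable_fun D f /\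
  (\int[mu]_(x in D) (`|f x| `^ p)%:E <= C%:E)%E].

Lemma measurable_normr_powR (f : T -> R) : measurable_fun D f ->
  measurable_fun D (fun x => `|f x| `^ p).
Proof.
move=> mf; apply: (measurableT_comp (measurable_powR p)).
exact: measurableT_comp.
Qed.

Lemma integrable_normr_powR f : Lp_ball f ->
  mu.-integrable D (fun x => (`|f x| `^ p)%:E).
Proof.
move=> [mf fC]; apply/integrableP; split.
  exact/measurable_EFinP/measurable_normr_powR.
under eq_integral do rewrite gee0_abs ?lee_fin ?powR_ge0//.
by rewrite (le_lt_trans fC) ?ltry.
Qed.

Lemma integrable_cst_fin (r : R) : mu.-integrable D (fun=> r%:E).
Proof.
apply/integrableP; split; first exact: measurable_cst.
by rewrite integral_cst//= lte_mul_pinfty.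
Qed.

Lemma Lp_ball_integrable f : Lp_ball f -> mu.-integrable D (EFin \o f).
Proof.
move=> fC; have [mf _] := fC.
apply: (le_integrable mD _ _ (integrableD mD (integrable_cst_fin 1) (integrable_normr_powR fC))).
  exact/measurable_EFinP.
move=> x Dx; rewrite /= lee_fin [leRHS]ger0_norm ?addr_ge0 ?powR_ge0//.
exact: (le1_powR (ltW p1)).
Qed.

Lemma Lp_ball_midpoint f g : Lp_ball f -> Lp_ball g ->
  Lp_ball (fun x => (f x + g x) / 2).
Proof.
move=> fC gC; have [mf If] := fC; have [mg Ig] := gC; split.
  by apply: measurable_funM => //; exact: measurable_funD.
have mm : measurable_fun D (fun x => (f x + g x) / 2).
  by apply: measurable_funM => //; exact: measurable_funD.
apply: (@le_trans _ _ (\int[mu]_(x in D)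
   ((2^-1)%:E * ((`|f x| `^ p)%:E + (`|g x| `^ p)%:E)))%E).
  apply: ge0_le_integral => //.
  - exact/measurable_EFinP/measurable_normr_powR.
  - apply/measurable_EFinP/measurable_funM => //.
    by apply: measurable_funD; exact: measurable_normr_powR.
  - by move=> x _; rewrite -EFinD -EFinM lee_fin (mulrC 2^-1) midpoint_powR// ltW.
rewrite integralZl//; last by apply: integrableD => //; exact: integrable_normr_powR.
rewrite integralD//; [|exact: integrable_normr_powR..].
rewrite (_ : C%:E = (2^-1)%:E * (C%:E + C%:E))%E; last first.
  by rewrite -EFinD -EFinM; congr EFin; field.
by apply: lee_wpmul2l; [rewrite lee_fin invr_ge0|exact: leeD].
Qed.

Lemma Lp_ball_hull A : A `<=` Lp_ball -> midpoint_hull A `<=` Lp_ball.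
Proof.
by move=> AB f; elim=> [g /AB//|g h _ gB _ hB]; exact: Lp_ball_midpoint.
Qed.

Lemma measurable_sqrt1D (f : T -> R) : measurable_fun D f ->
  measurable_fun D (sqrt1D \o f).
Proof.
move=> mf; apply: (measurableT_comp (continuous_measurable_fun (@sqrt_continuous R))).
by apply: measurable_funD => //; exact: measurable_funX.
Qed.

Lemma integrable_sqrt1D f : Lp_ball f -> mu.-integrable D (EFin \o (sqrt1D \o f)).
Proof.
move=> fC; apply: (le_integrable mD _ _ (integrableD mD (integrable_cst_fin 1)
   (integrable_norm (Lp_ball_integrable fC)))).
  exact/measurable_EFinP/measurable_sqrt1D/fC.1.
move=> x Dx; rewrite /= lee_fin [leLHS]ger0_norm ?sqrtr_ge0//.
by rewrite [leRHS]ger0_norm ?addr_ge0// sqrt1D_le.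
Qed.

Definition sqrt1D_energy (f : T -> R) : R := Rintegral mu D (sqrt1D \o f).

Lemma sqrt1D_energy_ge0 f : 0 <= sqrt1D_energy f.
Proof. by apply: Rintegral_ge0 => x _; rewrite sqrtr_ge0. Qed.

Lemma sqrt1D_energy_le f : Lp_ball f -> sqrt1D_energy f <= 2 * fine (mu D) + C.
Proof.
move=> fC; have ip := integrable_normr_powR fC.
apply: (@le_trans _ _ (\int[mu]_(x in D) (2 + `|f x| `^ p))).
  apply: le_Rintegral => //; first exact: integrable_sqrt1D.
    by apply: (integrableD mD (integrable_cst_fin 2) ip).
  move=> x _ /=; apply: le_trans (sqrt1D_le _) _.
  by have := le1_powR (ltW p1) (normr_ge0 (f x)); lra.
rewrite RintegralD//; last exact: integrable_cst_fin.
rewrite Rintegral_cst// lerD2l -lee_fin fineK; first exact: fC.2.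
exact: integrable_fin_num.
Qed.

Lemma L1_dist_le_gap (M e : R) f g : Lp_ball f -> Lp_ball g -> 1 <= M -> 0 < e ->
  \int[mu]_(x in D) `|f x - g x| <= e * fine (mu D) +
    M ^+ 3 * 32 / e * (sqrt1D_energy f + sqrt1D_energy g -
       sqrt1D_energy (fun x => (f x + g x) / 2) * 2) +
    M `^ (1 - p) * 2 * (C + C).
Proof.
move=> fC gC M1 e0.
have If := integrable_sqrt1D fC; have Ig := integrable_sqrt1D gC.
have Ip h : Lp_ball h -> \int[mu]_(x in D) (`|h x| `^ p) <= C.
  move=> hC; rewrite -lee_fin fineK; first exact: hC.2.
  by apply: integrable_fin_num => //; exact: integrable_normr_powR.
have Im := integrable_sqrt1D (Lp_ball_midpoint fC gC).
have ipf := integrable_normr_powR fC; have ipg := integrable_normr_powR gC.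
set K := M ^+ 3 * 32 / e; set L := M `^ (1 - p) * 2.
have L0 : 0 <= L by rewrite mulr_ge0 ?powR_ge0.
have IfD : mu.-integrable D (EFin \o (fun x => sqrt1D (f x) + sqrt1D (g x))).
  exact: (integrableD mD If Ig).
have Im2 : mu.-integrable D (EFin \o (fun x => sqrt1D ((f x + g x) / 2) * 2)).
  exact: (integrableZr mD 2 Im).
have Ig' : mu.-integrable D (EFin \o (fun x => sqrt1D (f x) + sqrt1D (g x) -
    sqrt1D ((f x + g x) / 2) * 2)) by exact: (integrableB mD IfD Im2).
have Ipp : mu.-integrable D (EFin \o (fun x => `|f x| `^ p + `|g x| `^ p)).
  exact: (integrableD mD ipf ipg).
have IK := integrableZl mD K Ig'; have IL := integrableZl mD L Ipp.
have Ie := integrable_cst_fin e.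
have IeK := integrableD mD Ie IK.
have -> : e * fine (mu D) + K * (sqrt1D_energy f + sqrt1D_energy g -
       sqrt1D_energy (fun x => (f x + g x) / 2) * 2) =
    \int[mu]_(x in D) (e + K * (sqrt1D (f x) + sqrt1D (g x) -
    sqrt1D ((f x + g x) / 2) * 2)).
  rewrite RintegralD// Rintegral_cst// RintegralZl// RintegralB// RintegralD//.
  by rewrite RintegralZr.
apply: (@le_trans _ _ (\int[mu]_(x in D) (e + K * (sqrt1D (f x) + sqrt1D (g x) -
    sqrt1D ((f x + g x) / 2) * 2)) + \int[mu]_(x in D) (L * (`|f x| `^ p + `|g x| `^ p)))).
  rewrite -RintegralD//.
  apply: le_Rintegral => //.
  - exact: (integrable_norm (integrableB mD (Lp_ball_integrable fC) (Lp_ball_integrable gC))).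
  - exact: (integrableD mD IeK IL).
  - by move=> x _; exact: dist_le_gap.
rewrite lerD2l RintegralZl// ler_wpM2l// RintegralD//; apply: lerD; exact: Ip.
Qed.


(** The witness M = min(k, 1)^(-1/(p-1)) gives M^(1-p) = min(k, 1); the cap at 1 ensures M >= 1. *)
Lemma powR_small (k : R) : 0 < k -> exists2 M : R, 1 <= M & M `^ (1 - p) <= k.
Proof.
move=> k0; pose k' := Num.min k 1; have k'0 : 0 < k' by rewrite lt_min k0/=.
have q0 : 0 < (p - 1)^-1 by rewrite invr_gt0 subr_gt0.
exists (k' `^ (- (p - 1)^-1)).
  rewrite powRN invf_ge1 ?powR_gt0//.
  apply: (@le_trans _ _ (1 `^ (p - 1)^-1)); last by rewrite powR1.
  by rewrite ge0_ler_powR ?nnegrE ?ge_min ?lexx ?orbT// ltW.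
rewrite -powRrM -(opprB p) mulrNN mulVf ?gt_eqF ?subr_gt0//.
by rewrite powRr1 ?(ltW k'0)// /k' ge_min lexx.
Qed.

(** Uniform convexity of [sqrt1D_energy] on the ball, measured in L^1. Each term of [L1_dist_le_gap]
    gets e / 3: the first fixes [e1], the tail fixes [M], and the gap then fixes [eta]. *)
Lemma L1_dist_small (e : R) : 0 < e -> exists2 eta, 0 < eta &
  forall f g, Lp_ball f -> Lp_ball g ->
    sqrt1D_energy f + sqrt1D_energy g -
      sqrt1D_energy (fun x => (f x + g x) / 2) * 2 <= eta ->
  \int[mu]_(x in D) `|f x - g x| <= e.
Proof.
move=> e0; have m0 : 0 <= fine (mu D) by exact: fine_ge0.
(* The summand 1 keeps the denominators positive when the measure of [D] or [C] vanishes. *)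
have e10 : 0 < e / 3 / (1 + fine (mu D)) by rewrite !divr_gt0//; lra.
have k0 : 0 < e / 3 / (1 + `|C| * 4).
  by rewrite !divr_gt0//; have := normr_ge0 C; lra.
have [M M1 MC] := powR_small k0.
set e1 := e / 3 / _ in e10; set k := _ / _ in MC k0.
have K0 : 0 < M ^+ 3 * 32 / e1 by rewrite divr_gt0 ?mulr_gt0 ?exprn_gt0//; lra.
exists (e / 3 / (M ^+ 3 * 32 / e1)); first by rewrite divr_gt0// divr_gt0.
move=> f g fC gC; rewrite ler_pdivlMr// mulrC => h.
apply: le_trans (L1_dist_le_gap fC gC M1 e10) _.
have l1 : e1 * fine (mu D) <= e / 3.
  rewrite /e1 -mulrA ler_piMr ?divr_ge0 ?(ltW e0)//.
  rewrite mulrC ler_pdivrMr; lra.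
have l2 : M `^ (1 - p) * 2 * (C + C) <= e / 3.
  apply: (@le_trans _ _ (k * (`|C| * 4))).
    rewrite -mulrA; apply: (@le_trans _ _ (M `^ (1 - p) * (`|C| * 4))).
      by rewrite ler_wpM2l ?powR_ge0//; have := ler_norm C; lra.
    by rewrite ler_wpM2r// mulr_ge0.
  have C0 := normr_ge0 C.
  rewrite /k -mulrA ler_piMr ?divr_ge0 ?(ltW e0)//.
  rewrite mulrC ler_pdivrMr; lra.
lra.
Qed.

(** The infima [m n] of the energy over the hulls of the tails are nondecreasing and bounded.
    Near-minimizers [g n], taken with error 1/(n+1), therefore have small midpoint gaps, and uniform
    convexity makes them Cauchy. *)
Lemma minimizing_cauchy (f : nat -> T -> R) : (forall k, Lp_ball (f k)) ->
  exists g : nat -> T -> R,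
    (forall n, midpoint_hull [set f k | k in [set k | (n <= k)%N]] (g n)) /\
    forall e, 0 < e -> exists n0, forall n l, (n0 <= n)%N -> (n <= l)%N ->
      \int[mu]_(x in D) `|g n x - g l x| <= e.
Proof.
move=> fC; pose H n := midpoint_hull [set f k | k in [set k | (n <= k)%N]].
have HB n : H n `<=` Lp_ball by apply: Lp_ball_hull => _ [k _ <-].
have HS n l : (n <= l)%N -> H l `<=` H n.
  move=> nl; apply: midpoint_hullS => _ [k /= lk <-]; exists k => //=.
  exact: leq_trans nl lk.
have Hf n : H n (f n) by apply: midpoint_hull_in; exists n => /=.
pose S n := [set sqrt1D_energy h | h in H n].
have Slb n : has_inf (S n).
  split; first by exists (sqrt1D_energy (f n)); exists (f n).
  by exists 0 => _ [h _ <-]; exact: sqrt1D_energy_ge0.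
pose m n := inf (S n).
have mle n h : H n h -> m n <= sqrt1D_energy h.
  by move=> Hh; apply: ge_inf; [exact: (Slb n).2|exists h].
have mub : has_sup (range m).
  split; first by exists (m 0%N), 0%N.
  exists (2 * fine (mu D) + C) => _ [n _ <-].
  exact: le_trans (mle _ _ (Hf n)) (sqrt1D_energy_le (fC n)).
have msup n : m n <= sup (range m) by apply: ub_le_sup; [exact: mub.2|exists n].
have mnd n l : (n <= l)%N -> m n <= m l.
  move=> nl; apply: lb_le_inf; first exact: (Slb l).1.
  by move=> _ [h Hh <-]; apply: mle; exact: HS Hh.
have /choice[g gH] : forall n, exists h, H n h /\
    sqrt1D_energy h < m n + n.+1%:R^-1.
  move=> n; have n0 : 0 < (n.+1%:R^-1 : R) by [].
  by have [_ [h Hh <-] hlt] := inf_adherent n0 (Slb n); exists h.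
exists g; split => [n|e e0]; first by have [] := gH n.
have [eta eta0 He] := L1_dist_small e0.
(* One third for the increase of [m] beyond [n1], and one for each of the errors 1/(n+1) and
   1/(l+1). *)
have eta2 : 0 < eta / 3 by rewrite divr_gt0.
have [_ [n1 _ <-] n1s] := sup_adherent eta2 mub.
have [n2 n2e] := ltr_add_invr eta2; rewrite add0r in n2e.
exists (maxn n1 n2) => n l; rewrite geq_max => /andP[n1n n2n] nl.
have [gn gne] := gH n; have [gl gle] := gH l.
apply: He; [exact: HB gn|exact: HB gl|].
(* The midpoint stays in the hull of the tail from [n], as n <= l; the gap is thus at most m l - m n
   plus the two errors. *)
have hm : m n <= sqrt1D_energy (fun x => (g n x + g l x) / 2).
  by apply: mle; apply: midpoint_hull_mid => //; exact: HS gl.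
have inv k : (n2 <= k)%N -> (k.+1%:R^-1 : R) <= n2.+1%:R^-1.
  by move=> n2k; rewrite lef_pV2 ?posrE// ler_nat ltnS.
move: (inv _ n2n) (inv _ (leq_trans n2n nl)) (mnd _ _ n1n) (msup l).
move: hm gle gne n2e n1s; clear.
move: (sqrt1D_energy _) (sqrt1D_energy (g n)) (sqrt1D_energy (g l)).
move: (m n) (m l) (m n1) (sup _) (n.+1%:R^-1) (l.+1%:R^-1) (n2.+1%:R^-1).
by move=> *; lra.
Qed.

End weak_limit.

(** * Lower limits and subsequences converging almost everywhere *)

Lemma cvg_powR {R : realType} (u : nat -> R) (a p : R) : 1 < p ->
  (forall n, 0 <= u n) -> u @ \oo --> a -> (fun n => u n `^ p) @ \oo --> a `^ p.
Proof.
move=> p1 u0 ua; have a0 : 0 <= a.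
  rewrite -(cvg_lim _ ua)//; apply: limr_ge; first by apply/cvg_ex; exists a.
  exact: nearW.
have [a00|ane0] := eqVneq a 0; last first.
  have ap : 0 < a by rewrite lt_neqAle eq_sym ane0.
  apply: (@continuous_cvg _ _ _ _ _ _ (@powR R ^~ p)) => //.
  apply: differentiable_continuous; apply/derivable1_diffP.
  by apply: derivable_powR; rewrite in_itv/= ap.
rewrite a00 in ua; rewrite a00 powR0 ?gt_eqF//; last lra.
apply: (squeeze_cvgr _ (cvg_cst 0) ua).
have u1 : \forall n \near \oo, u n <= 1.
  by apply: (cvgr_le 0).
apply: filterS u1 => n un1; rewrite powR_ge0/=.
have [->|un0] := eqVneq (u n) 0; first by rewrite powR0//; lra.
by rewrite ge1r_powR ?(ltW p1)// un1 andbT lt_neqAle eq_sym un0 u0.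
Qed.

Lemma limn_einf_ge {R : realType} (u : nat -> \bar R) (c : \bar R) :
  (forall n, c <= u n)%E -> (c <= limn_einf u)%E.
Proof.
move=> cu; rewrite limn_einf_lim; apply: lime_ge; first exact: is_cvg_einfs.
by apply: nearW => n; apply: le_ereal_inf_tmp => _ [k _ <-].
Qed.

Lemma limn_einf_le {R : realType} (u : nat -> \bar R) (c : \bar R) :
  (forall n, u n <= c)%E -> (limn_einf u <= c)%E.
Proof.
move=> uc; rewrite limn_einf_lim; apply: lime_le; first exact: is_cvg_einfs.
apply: nearW => n; apply: le_trans (uc n).
by apply: ereal_inf_lbound; exists n => /=.
Qed.

Section L1_limit.
Context d (T : measurableType d) (R : realType).
Variables (mu : {measure set T -> \bar R}) (D : set T).
Hypotheses (mD : measurable D).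

(** The Riesz-Fischer argument: along [s] the increments have L^1 norms at most 2^-(k+1), so their
    absolute sum [F] is integrable, hence finite almost everywhere, and |g (s 0)| + F dominates the
    subsequence. *)
Lemma L1_cauchy_subseq (g : nat -> T -> R) :
  (forall n, mu.-integrable D (EFin \o g n)) ->
  (forall e, 0 < e -> exists n0, forall n l, (n0 <= n)%N -> (n <= l)%N ->
      \int[mu]_(x in D) `|g n x - g l x| <= e) ->
  exists s : nat -> nat, exists h : T -> R, exists G : T -> \bar R,
    [/\ forall n, (n <= s n)%N, measurable_fun D h,
       {ae mu, forall x, D x -> (fun n => g (s n) x) @ \oo --> h x},
       mu.-integrable D G &
       forall x n, D x -> (`|g (s n) x|%:E <= G x)%E].
Proof.
move=> ig gcauchy.
have /choice[N HN] : forall k, exists n0, forall n l, (n0 <= n)%N -> (n <= l)%N ->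
      \int[mu]_(x in D) `|g n x - g l x| <= 1 / (2 ^ (k + 1))%:R.
  by move=> k; apply: gcauchy; rewrite divr_gt0// ltr0n expn_gt0.
(* Summing the successors makes [s] increasing with both [N k] and [k] below [s k]. *)
pose s k := (\sum_(i < k.+1) (N i).+1)%N.
have sS k : s k.+1 = (s k + (N k.+1).+1)%N by rewrite /s big_ord_recr.
have sk k : (k <= s k)%N.
  by elim: k => // k ih; rewrite sS; lia.
have Ns k : (N k <= s k)%N.
  by rewrite /s big_ord_recr/=; lia.
pose a k x := `|g (s k.+1) x - g (s k) x|.
have ia k : mu.-integrable D (EFin \o a k).
  exact: (integrable_norm (integrableB mD (ig _) (ig _))).
have ale k : (\int[mu]_(x in D) (a k x)%:E <= (1 / (2 ^ (k + 1))%:R)%:E)%E.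
  rewrite -(fineK (integrable_fin_num mD (ia k))) lee_fin.
  rewrite (_ : fine _ = \int[mu]_(x in D) `|g (s k) x - g (s k.+1) x|).
    by apply: HN => //; rewrite sS leq_addr.
  by apply: eq_Rintegral => x _; rewrite /a distrC.
pose F x := (\sum_(k <oo) (a k x)%:E)%E.
have a0 k x : (0 <= (a k x)%:E)%E by rewrite lee_fin normr_ge0.
have mF : measurable_fun D F.
  apply: ge0_emeasurable_sum => // k _; exact: (measurable_int mu (ia k)).
have F0 x : (0 <= F x)%E by apply: nneseries_ge0.
have iF : mu.-integrable D F.
  apply/integrableP; split => //.
  under eq_integral do rewrite gee0_abs//.
  rewrite /F integral_nneseries//; last first.
    by move=> k; exact: (measurable_int mu (ia k)).
  apply: (@le_lt_trans _ _ (\sum_(k <oo) (1 / (2 ^ (k + 1))%:R)%:E)%E).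
    apply: lee_nneseries => [k _ _|k _]; last exact: ale.
    by apply: integral_ge0 => x _; exact: a0.
  by rewrite (cvg_lim _ (@cvg_geometric_eseries_half R (1%R : R) 0))// ltry.
pose G x := (`|g (s 0) x|%:E + F x)%E.
have iG : mu.-integrable D G.
  exact: (integrableD mD (integrable_norm (ig _)) iF).
have gS x n : g (s n) x = g (s 0%N) x + \sum_(0 <= k < n) (g (s k.+1) x - g (s k) x).
  by rewrite telescope_sumr// subrKC.
have gG x n : D x -> (`|g (s n) x|%:E <= G x)%E.
  move=> Dx; apply: (@le_trans _ _ (`|g (s 0) x|%:E + \sum_(0 <= k < n) (a k x)%:E)%E).
    rewrite sumEFin -EFinD lee_fin gS (le_trans (ler_normD _ _))// lerD2l.
    exact: ler_norm_sum.
  by rewrite leeD2l//; exact: nneseries_lim_ge.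
have gcvg x : D x -> (F x < +oo)%E -> cvgn (fun n => g (s n) x).
  move=> Dx Fx.
  have : cvgn [series a k x]_k.
    apply: nondecreasing_is_cvgn.
      by apply/nondecreasing_seqP => n; rewrite /series /= big_nat_recr//= lerDl normr_ge0.
    exists (fine (F x)) => _ [n _ <-].
    rewrite -lee_fin fineK ?ge0_fin_numE// /series/= -sumEFin.
    exact: nneseries_lim_ge.
  move=> /normed_cvg h.
  rewrite (_ : (fun n => _) = (fun n => g (s 0%N) x + [series g (s k.+1) x - g (s k) x]_k n)).
    by apply: is_cvgD => //; exact: is_cvg_cst.
  by apply/funext => n; rewrite gS.
(* Cutting to 0 where [F] is infinite makes the sequence converge at every point of [D], so that its
   limit is measurable. *)
pose A := D `&` [set x | (F x < +oo)%E].
have mA : measurable A by apply: emeasurable_fun_infty_o.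
pose g' n := g (s n) \_ A.
have mg' n : measurable_fun D (g' n).
  apply: measurable_funTS; apply/(measurable_restrictT _ mA).1.
  apply: (@measurable_funS _ _ _ _ D) => //; first by move=> ? [].
  exact/measurable_EFinP/(measurable_int mu (ig _)).
have g'cvg x : D x -> cvgn (g' ^~ x).
  move=> Dx; rewrite /g' /patch; case: (boolP (x \in A)) => [|_].
    by rewrite inE => -[_ Fx]; exact: gcvg.
  exact: is_cvg_cst.
exists s, (fun x => limn (g' ^~ x)), G; split => //.
  exact: measurable_fun_cvg mg' g'cvg.
have [Z [mZ Z0 HZ]] := integrable_ae mD iF.
exists Z; split => // x /= nx; apply: HZ => /= Fx; apply: nx => Dx.
have Ax : A x by split=> //=; rewrite -ge0_fin_numE//; exact: Fx.
have := g'cvg x Dx; rewrite /g' /patch mem_set//.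
Qed.
End L1_limit.

(** * Weak limits against bounded test functions *)

Section weak_Lp_limit.
Context d (T : measurableType d) (R : realType).
Variables (mu : {measure set T -> \bar R}) (D : set T).
Hypotheses (mD : measurable D) (Dfin : (mu D < +oo)%E).
Variables (p C : R) (p1 : 1 < p).

Lemma bounded_mul_integrable (phi f : T -> R) (M : R) :
  measurable_fun D phi -> (forall x, D x -> `|phi x| <= M) ->
  mu.-integrable D (EFin \o f) ->
  mu.-integrable D (EFin \o (fun x => phi x * f x)).
Proof.
move=> mphi phiM fi; have mf : measurable_fun D f.
  exact/measurable_EFinP/(measurable_int mu fi).
apply: (le_integrable mD _ _ (integrableZl mD M (integrable_norm fi))).
  exact/measurable_EFinP/measurable_funM.
move=> x Dx; rewrite /= lee_fin 2!normrM normr_id ler_wpM2r//.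
exact: le_trans (phiM _ Dx) (ler_norm _).
Qed.

(** Being within e of l is a convex condition on a linear functional; the L^p ball supplies the
    integrability that linearity requires. *)
Lemma midpoint_hull_Rintegral (A : set (T -> R)) (phi : T -> R) (M l e : R) :
  measurable_fun D phi -> (forall x, D x -> `|phi x| <= M) ->
  A `<=` Lp_ball mu D p C ->
  (forall f, A f -> `|\int[mu]_(x in D) (phi x * f x) - l| <= e) ->
  forall f, midpoint_hull A f ->
    `|\int[mu]_(x in D) (phi x * f x) - l| <= e.
Proof.
move=> mphi phiM AB Ae f; elim=> [//|{}f g hf fe hg ge].
have HB := Lp_ball_hull mD p1 AB.
have If : mu.-integrable D (EFin \o (fun x => phi x * f x)).
  exact: bounded_mul_integrable phiM (Lp_ball_integrable mD Dfin p1 (HB _ hf)).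
have Ig : mu.-integrable D (EFin \o (fun x => phi x * g x)).
  exact: bounded_mul_integrable phiM (Lp_ball_integrable mD Dfin p1 (HB _ hg)).
have -> : \int[mu]_(x in D) (phi x * ((f x + g x) / 2)) =
    (\int[mu]_(x in D) (phi x * f x) + \int[mu]_(x in D) (phi x * g x)) * 2^-1.
  rewrite -RintegralD// -RintegralZr//; last exact: (integrableD mD If Ig).
  by apply: eq_Rintegral => x _; rewrite mulrA mulrDr.
move: fe ge; rewrite !ler_norml; move: (Rintegral _ _ _) (Rintegral _ _ _) => u v; lra.
Qed.

(* Weak sequential compactness without duality: midpoint averages of tails that
   nearly minimize the strictly convex functional [sqrt1D_energy] converge in
   L^1, and averaging does not change the limit against a fixed [phi]. *)
Lemma weak_Lp_limit (f : nat -> T -> R) : (forall k, Lp_ball mu D p C (f k)) ->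
  exists2 h, Lp_ball mu D p C h & forall (phi : T -> R) M l, measurable_fun D phi ->
    (forall x, D x -> `|phi x| <= M) ->
    (fun k => \int[mu]_(x in D) (phi x * f k x)) @ \oo --> l ->
    \int[mu]_(x in D) (phi x * h x) = l.
Proof.
move=> fC; have [g [gH gcauchy]] := minimizing_cauchy mD Dfin p1 fC.
have gC n : Lp_ball mu D p C (g n).
  by apply: (Lp_ball_hull mD p1 _ (gH n)) => _ [k _ <-].
have ig n := Lp_ball_integrable mD Dfin p1 (gC n).
have [s [h [G [sk mh gh iG gG]]]] := L1_cauchy_subseq mD ig gcauchy.
have mg n : measurable_fun D (g n) := (gC n).1.
exists h.
  split => //.
  have mgp n : measurable_fun D (fun x => (`|g (s n) x| `^ p)%:E).
    exact/measurable_EFinP/measurable_normr_powR.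
  have gp0 n x : D x -> (0 <= (`|g (s n) x| `^ p)%:E)%E.
    by rewrite lee_fin powR_ge0.
  (* Fatou's lemma keeps the limit in the same ball. *)
  apply: (@le_trans _ _ (\int[mu]_(x in D) limn_einf (fun n => (`|g (s n) x| `^ p)%:E))%E).
    apply: ae_ge0_le_integral => //.
    - exact/measurable_EFinP/measurable_normr_powR.
    - by move=> x Dx; apply: limn_einf_ge => n; exact: gp0.
    - apply: measurableT_comp => //; apply: measurable_fun_limn_esup => n.
      exact: measurableT_comp.
    - case: gh => Z [mZ Z0 HZ]; exists Z; split => // x /= nx; apply: HZ => /= gx.
      apply: nx => Dx; rewrite (_ : limn_einf _ = (`|h x| `^ p)%:E)//.
      apply cvg_limn_einf_sup; apply: cvg_EFin; first exact: nearW.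
      by apply: cvg_powR => //; apply: cvg_norm; exact: gx.
  apply: le_trans (fatou _ mD mgp gp0) _.
  by apply: limn_einf_le => n; exact: (gC _).2.
move=> phi M l mphi phiM phil.
have Mr x : D x -> `|phi x| <= `|M|.
  by move=> Dx; exact: le_trans (phiM _ Dx) (ler_norm _).
have mphig n : measurable_fun D (fun x => (phi x * g (s n) x)%:E).
  exact/measurable_EFinP/measurable_funM.
have mphih : measurable_fun D (fun x => (phi x * h x)%:E).
  exact/measurable_EFinP/measurable_funM.
have cv : {ae mu, forall x, D x ->
    (fun n => (phi x * g (s n) x)%:E) @ \oo --> (phi x * h x)%:E}.
  case: gh => Z [mZ Z0 HZ]; exists Z; split => // x /= nx; apply: HZ => /= gx.
  apply: nx => Dx; apply: cvg_EFin; first exact: nearW.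
  by apply: cvgM; [exact: cvg_cst|exact: gx].
have dom : {ae mu, forall x n, D x -> (`|(phi x * g (s n) x)%:E| <= `|M|%:E * G x)%E}.
  apply: aeW => x n Dx; rewrite abse_EFin normrM EFinM lee_pmul//.
  - by rewrite lee_fin Mr.
  - exact: gG.
have [ih _ lim1] := dominated_convergence mD mphig mphih cv (integrableZl mD `|M| iG) dom.
have {}lim1 : (fun n => \int[mu]_(x in D) (phi x * g (s n) x)) @ \oo -->
    \int[mu]_(x in D) (phi x * h x).
  apply: fine_cvg; rewrite fineK; first exact: lim1.
  exact: (integrable_fin_num mD ih).
(* [g (s n)] averages terms of index at least s n >= n; beyond [n0] all of these have integrals
   within e of [l]. *)
apply: (cvg_unique _ lim1) => //.
apply/cvgrPdist_le => e e0.
have /cvgrPdist_le/(_ e e0)[n0 _ Hn0] := phil.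
exists n0 => // n /= n0n; rewrite distrC.
apply: (midpoint_hull_Rintegral mphi phiM _ _ (gH (s n))).
  by move=> _ [k _ <-].
move=> _ [k /= snk <-]; rewrite distrC; apply: Hn0 => /=.
by rewrite (leq_trans n0n)// (leq_trans (sk n)).
Qed.
End weak_Lp_limit.

(** * Borel sets are Lebesgue measurable *)

Section lebesgue.
Context {R : realType} {n : nat}.
Notation X := 'rV[R]_n.
Implicit Types (a b : X) (i : 'I_n) (c : R).

Lemma leb_outer_le_box_volume (C : set X) : (leb_outer C <= box_volume C)%E.
Proof.
apply: ereal_inf_lbound; exists (fun k : nat => if k is 0%N then C else set0 : set X).
  by split=> [k|t Xt]; [exact: sub_sigma_algebra|exists 0%N].
apply/cvg_lim => //; rewrite -cvg_shiftS.
rewrite (_ : [sequence _]_n = cst (box_volume C)); first exact: cvg_cst.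
by rewrite funeqE => k /=; rewrite big_nat_recl//= big1 ?adde0// => j _; rewrite box_volume0.
Qed.

Lemma leb_outer_box a b : (forall i, a ord0 i <= b ord0 i) ->
  (leb_outer (box a b) <= (\prod_i (b ord0 i - a ord0 i))%:E)%E.
Proof.
move=> ab; apply: le_trans (leb_outer_le_box_volume _) _.
by apply: ereal_inf_lbound; right; exists a, b.
Qed.

Definition below i c : set X := [set x | x ord0 i <= c].

Definition set_coord a i c : X := \row_j (if j == i then c else a ord0 j).

(** A cut at height c strictly inside the box leaves two boxes sharing a face, whose volumes add up;
    otherwise one of the two pieces is empty. *)
Lemma leb_outer_split_box a b i c : (forall i, a ord0 i <= b ord0 i) ->
  (leb_outer (box a b `&` below i c) + leb_outer (box a b `&` ~` below i c)
    <= (\prod_i (b ord0 i - a ord0 i))%:E)%E.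
Proof.
move=> ab.
have [ca|ac] := ltP c (a ord0 i).
  rewrite (_ : _ `&` below i c = set0) ?outer_measure0 ?add0e; last first.
    apply/seteqP; split => // x [/(_ i)/andP[ax _]]; rewrite /below /= => xc.
    by move: ax; rewrite leNgt (le_lt_trans xc).
  by apply: le_trans (leb_outer_box ab); apply: le_outer_measure => x [].
have [bc|cb] := leP (b ord0 i) c.
  rewrite (_ : _ `&` ~` below i c = set0) ?outer_measure0 ?adde0; last first.
    apply/seteqP; split => // x [/(_ i)/andP[_ xb]]; apply.
    by rewrite /below /= (le_trans xb).
  by apply: le_trans (leb_outer_box ab); apply: le_outer_measure => x [].
have ab1 j : a ord0 j <= (set_coord b i c) ord0 j.
  by rewrite mxE; case: eqP => [->|].
have ab2 j : (set_coord a i c) ord0 j <= b ord0 j.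
  by rewrite mxE; case: eqP => [->|]; rewrite // ltW.
apply: (@le_trans _ _ (leb_outer (box a (set_coord b i c)) +
    leb_outer (box (set_coord a i c) b))%E).
  apply: leeD; apply: le_outer_measure => x [] xab xc j; rewrite mxE.
    by case: eqP (xab j) => [->|//] /andP[-> _].
  case: eqP (xab j) => [->|//] /andP[_ ->]; rewrite andbT ltW// ltNge.
  exact/negP.
apply: le_trans (leeD (leb_outer_box ab1) (leb_outer_box ab2)) _.
rewrite -EFinD lee_fin (bigD1 i)//= [X in _ + X](bigD1 i)//= [leRHS](bigD1 i)//=.
rewrite !mxE eqxx.
rewrite (eq_bigr (fun j => b ord0 j - a ord0 j)); last first.
  by move=> j /negbTE ji; rewrite mxE ji.
rewrite [X in _ + _ * X](eq_bigr (fun j => b ord0 j - a ord0 j)); last first.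
  by move=> j /negbTE ji; rewrite mxE ji.
by rewrite -mulrDl addrC addrA subrK.
Qed.

(** Each member of a covering can be split separately: a box by the previous lemma, while a set that
    is neither empty nor a box has gauge +oo. *)
Lemma below_caratheodory i c : (@leb_outer R n).-caratheodory (below i c).
Proof.
apply: le_caratheodory_measurable => A.
apply: le_ereal_inf_tmp => _ [B [_ AB] <-].
have key k : (leb_outer (B k `&` below i c) + leb_outer (B k `&` ~` below i c)
    <= box_volume (B k))%E.
  apply: le_ereal_inf_tmp => v [[-> ->]|[a [b [ab -> ->]]]].
    by rewrite !set0I outer_measure0 adde0.
  exact: leb_outer_split_box.
have sub (Y : set X) :
    (leb_outer (A `&` Y) <= \sum_(k <oo) leb_outer (B k `&` Y))%E.
  apply: (@le_trans _ _ (leb_outer (\bigcup_k (B k `&` Y)))).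
    by apply: le_outer_measure; rewrite -setI_bigcupl; exact: setSI.
  exact: outer_measure_sigma_subadditive.
apply: le_trans (leeD (sub _) (sub _)) _.
rewrite -nneseriesD//; [|by move=> *; exact: outer_measure_ge0..].
by apply: lee_nneseries => // k _ _; rewrite adde_ge0// outer_measure_ge0.
Qed.

Lemma measurable_below i c : measurable (below i c : set (lebT R n)).
Proof. exact: below_caratheodory. Qed.

(** Half-open, so as to be a finite intersection of sets [below] and their complements. *)
Definition half_open_box a b : set X :=
  [set x | forall i, a ord0 i < x ord0 i <= b ord0 i].

Lemma measurable_half_open_box a b : measurable (half_open_box a b : set (lebT R n)).
Proof.
have -> : half_open_box a b = \bigcap_(i in [set: 'I_n])
    (~` below i (a ord0 i) `&` below i (b ord0 i)).
  apply/seteqP; split => [x abx i _|x abx i].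
    by have /andP[ax xb] := abx i; split => //; rewrite /below /= leNgt ax.
  by have [/negP + xb] := abx i I; rewrite -ltNge => ->.
apply: fin_bigcap_measurable => // i _.
by apply: measurableI; [apply: measurableC|]; exact: measurable_below.
Qed.

(** Balls of the sup norm are cubes, so rational corners fit between a point and the ball. The
    inclusion in [U] sits inside the sets so that the union runs over a countable type. *)
Lemma open_bigcup_half_open_box (U : set X) : open U ->
  U = \bigcup_(q : 'rV[rat]_n * 'rV[rat]_n)
    [set x | half_open_box (map_mx ratr q.1) (map_mx ratr q.2) `<=` U /\
             half_open_box (map_mx ratr q.1) (map_mx ratr q.2) x].
Proof.
move=> oU; apply/seteqP; split => [x Ux|x [q _ [qU /qU]]//].
have /nbhs_ballP[e /= e0 eU] : nbhs x U by exact: open_nbhs_nbhs.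
have /choice[q Hq] : forall i, exists q : rat * rat,
    x ord0 i - e < ratr q.1 < x ord0 i /\ x ord0 i < ratr q.2 < x ord0 i + e.
  move=> i; have xe : x ord0 i - e < x ord0 i by rewrite ltrBlDr ltrDl.
  have ex : x ord0 i < x ord0 i + e by rewrite ltrDl.
  have [q1] := rat_in_itvoo xe; have [q2] := rat_in_itvoo ex.
  by rewrite !in_itv/= => h1 h2; exists (q1, q2).
exists (\row_i (q i).1, \row_i (q i).2) => //=; split => [y qy|i].
  apply: eU; split => // j i; rewrite ord1 /ball/=.
  have := qy i; rewrite !mxE => /andP[y1 y2].
  have [/andP[q1 q2] /andP[q3 q4]] := Hq i.
  by rewrite ltr_norml; lra.
by rewrite !mxE; have [/andP[_ ->] /andP[/ltW -> _]] := Hq i.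
Qed.

Lemma open_measurable_leb (U : set X) : open U -> measurable (U : set (lebT R n)).
Proof.
move=> oU; rewrite (open_bigcup_half_open_box oU).
apply: (@countable_bigcupT_measurable _ (lebT R n)) => // q.
have [qU|qU] := pselect (half_open_box (map_mx ratr q.1) (map_mx ratr q.2) `<=` U).
  rewrite (_ : mkset _ = half_open_box (map_mx ratr q.1) (map_mx ratr q.2)).
    exact: measurable_half_open_box.
  by apply/seteqP; split => [x []|].
rewrite (_ : mkset _ = set0); first exact: measurable0.
by apply/seteqP; split => [x []|].
Qed.

Lemma borel_measurable_leb (B : set X) :
  measurable (B : set (borT R n)) -> measurable (B : set (lebT R n)).
Proof.
move: B; apply: smallest_sub; last by move=> U; exact: open_measurable_leb.
exact: (@sigma_algebra_measurable _ (lebT R n)).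
Qed.

(** The map along which Lebesgue densities become Borel measures. *)
Lemma measurable_id_leb_bor :
  measurable_fun [set: lebT R n] (id : lebT R n -> borT R n).
Proof. by move=> _ B mB; rewrite setTI; exact: borel_measurable_leb. Qed.

Lemma leb_bounded_lty (A : set X) : bounded_set A -> (leb R n A < +oo)%E.
Proof.
move=> [M' [_ /(_ (M' + 1))]]; rewrite ltrDl ltr01 => /(_ isT).
move: (M' + 1) => M AM.
pose c : X := const_mx (- M); pose e : X := const_mx M.
(* A point of [A] is what makes [M] nonnegative and the enclosing box admissible. *)
have [->|/set0P[x Ax]] := eqVneq A set0.
  by rewrite /leb outer_measure0.
have M0 : 0 <= M by rewrite (le_trans _ (AM x Ax)).
have ce i : c ord0 i <= e ord0 i by rewrite !mxE; lra.
apply: (@le_lt_trans _ _ (leb_outer (box c e))); last first.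
  by rewrite (le_lt_trans (leb_outer_box ce))// ltry.
apply: le_outer_measure => y /AM yM i; rewrite !mxE -ler_norml.
apply: le_trans yM; rewrite [leRHS]mx_normrE.
exact: (@le_bigmax _ _ _ _ (fun ij => `|y ij.1 ij.2|) (ord0, i)).
Qed.

Lemma within_continuous_measurable (Omega : set X) (phi : X -> R) :
  open Omega -> {within Omega, continuous phi} ->
  measurable_fun (Omega : set (borT R n)) phi.
Proof.
move=> oO cphi; apply: (measurability _ (RGenOpens.measurableE R)).
move=> _ [_ [a [b ->] <-]].
have oab : open `]a, b[%classic by exact: interval_open.
have /continuousP/(_ _ oab)/open_subspaceP[V oV VO] := cphi.
rewrite setIC -VO; apply: measurableI; exact: sub_sigma_algebra.
Qed.

Lemma C0_measurable (Omega : set X) (phi : X -> R) : open Omega ->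
  C0 Omega phi -> measurable_fun (Omega : set (borT R n)) phi.
Proof. by move=> oO [cphi _]; exact: within_continuous_measurable. Qed.

Lemma measurable_fun_bor_leb (Omega : set X) (phi : X -> R) :
  measurable (Omega : set (borT R n)) ->
  measurable_fun (Omega : set (borT R n)) phi ->
  measurable_fun (Omega : set (lebT R n)) phi.
Proof.
by move=> mO mphi _ B mB; apply: borel_measurable_leb; exact: mphi.
Qed.

Lemma C0_bounded (Omega : set X) (phi : X -> R) : C0 Omega phi ->
  exists M, forall x, Omega x -> `|phi x| <= M.
Proof.
move=> [cphi /(_ 1 ltr01)[K [cK KO Kphi]]].
have cK' : {within K, continuous phi} by exact: continuous_subspaceW cphi.
have /compact_bounded[M0 [_ /(_ (M0 + 1))]] := continuous_compact cK' cK.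
rewrite ltrDl ltr01 => /(_ isT) HM.
exists (Num.max (M0 + 1) 1) => x Ox; rewrite le_max.
have [Kx|nKx] := pselect (K x); first by rewrite HM//; exists x.
by rewrite (ltW (Kphi _ Ox nKx)) orbT.
Qed.

End lebesgue.

(** * Measures with a density *)

Section density.
Context d1 d2 (T1 : measurableType d1) (T2 : measurableType d2) (R : realType).
Variables (pi : T1 -> T2) (mpi : measurable_fun [set: T1] pi).
Variable mu : {measure set T1 -> \bar R}.

Let mpre (A : set T2) : measurable A -> measurable (pi @^-1` A).
Proof. by move=> mA; rewrite -[X in measurable X]setTI; exact: mpi. Qed.

Let tpre (F : nat -> set T2) :
  trivIset setT F -> trivIset setT (fun n => pi @^-1` F n).
Proof.
move=> tF; apply/trivIsetP => /= i j _ _ ij; rewrite -preimage_setI.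
by move/trivIsetP : tF => /(_ _ _ _ _ ij) ->//; rewrite preimage_set0.
Qed.

Section density_measure.
Variables (h : T1 -> R) (mh : measurable_fun setT h) (h0 : forall x, 0 <= h x).

(** The push-forward by [pi] of the measure with density [h]. The proofs are arguments so that the
    measure structure can be attached to the term. *)
Definition density_measure of measurable_fun setT pi &
    measurable_fun setT h & (forall x, 0 <= h x) :=
  fun A : set T2 => (\int[mu]_(x in pi @^-1` A) (h x)%:E)%E.

Local Notation m := (density_measure mpi mh h0).

Let m0 : m set0 = 0%E.
Proof. by rewrite /density_measure preimage_set0 integral_set0. Qed.

Let m_ge0 A : (0 <= m A)%E.
Proof. by apply: integral_ge0 => x _; rewrite lee_fin. Qed.

Let m_sigma : semi_sigma_additive m.
Proof.
move=> F mF tF mUF; rewrite /density_measure preimage_bigcup.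
apply: (@semi_sigma_additive_nng_induced _ _ _ mu (EFin \o h)) => //.
- exact/measurable_EFinP.
- by move=> n; exact: mpre.
- exact: tpre.
- by rewrite -preimage_bigcup; exact: mpre.
Qed.

HB.instance Definition _ := isMeasure.Build _ _ _ m m0 m_ge0 m_sigma.

Import HBNNSimple.

Lemma density_measure_nnsfun (g : {nnsfun T2 >-> R}) (E : set T2) : measurable E ->
  (\int[m]_(x in E) (g x)%:E = \int[mu]_(x in pi @^-1` E) ((g (pi x))%:E * (h x)%:E))%E.
Proof.
move=> mE.
have mg r : measurable_fun E (fun x => (r * \1_(g @^-1` [set r]) x)%:E).
  by apply/measurable_EFinP/measurable_funM.
have mgpi r : measurable_fun (pi @^-1` E) (fun x => (r * \1_(g @^-1` [set r]) (pi x))%:E).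
  apply/measurable_EFinP/measurable_funM => //.
  apply: measurable_funTS.
  by apply: (measurableT_comp _ mpi); exact: measurable_indic.
have mhE : measurable_fun (pi @^-1` E) (EFin \o h).
  by apply/measurable_EFinP/measurable_funTS.
transitivity (\int[m]_(x in E)
    (\sum_(y \in range g) (y * \1_(g @^-1` [set y]) x)%:E))%E.
  by apply: eq_integral => t tE; rewrite /= fimfunE -fsumEFin.
rewrite ge0_integral_fsum//; last by move=> r y Ey; exact: nnfun_muleindic_ge0.
transitivity (\int[mu]_(x in pi @^-1` E) (\sum_(y \in range g)
    (y * \1_(g @^-1` [set y]) (pi x))%:E * (h x)%:E))%E; last first.
  apply: eq_integral => x xE.
  rewrite -ge0_mule_fsuml => [|y]; last exact: nnfun_muleindic_ge0.
  by rewrite fsumEFin // -(fimfunE _ (pi x)).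
rewrite ge0_integral_fsum//; last 3 first.
- exact: mpre.
- by move=> y; apply: emeasurable_funM.
- by move=> r y Ey; apply: mule_ge0; [exact: nnfun_muleindic_ge0|rewrite lee_fin].
apply: eq_fsbigr => r rhn.
under eq_integral do rewrite EFinM.
rewrite integralZl_indic_nnsfun => //.
under [RHS]eq_integral do rewrite EFinM -muleA.
rewrite ge0_integralZl//.
- congr (_ * _)%E; rewrite integral_indic//.
  transitivity (\int[mu]_(x in pi @^-1` E `&` pi @^-1` (g @^-1` [set r])) (h x)%:E)%E.
    by rewrite setIC.
  rewrite integral_mkcondr.
  by apply: eq_integral => x _; rewrite epatch_indic muleC.
- exact: mpre.
- apply: emeasurable_funM => //; apply/measurable_EFinP/measurable_funTS.
  by apply: (measurableT_comp _ mpi); exact: measurable_indic.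
- by move=> t Et; rewrite mule_ge0 ?lee_fin.
- by move: rhn; rewrite inE => -[t _ <-]; rewrite lee_fin.
Qed.

Lemma ge0_integral_density (f : T2 -> R) (E : set T2) : measurable E ->
  measurable_fun E f -> (forall x, E x -> 0 <= f x) ->
  (\int[m]_(x in E) (f x)%:E = \int[mu]_(x in pi @^-1` E) (f (pi x) * h x)%:E)%E.
Proof.
move=> mE mf f0.
have mfE : measurable_fun E (EFin \o f) by exact/measurable_EFinP.
pose g := nnsfun_approx mE mfE.
have gf x : E x -> (fun n => (g n x)%:E) @ \oo --> (f x)%:E.
  by move=> Ex; apply: cvg_nnsfun_approx => //= y Ey; rewrite lee_fin f0.
have -> : (\int[m]_(x in E) (f x)%:E =
    lim (\int[m]_(x in E) (g n x)%:E @[n --> \oo]))%E.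
  under eq_integral => x /[!inE] Ex do rewrite -(cvg_lim _ (gf x Ex))//.
  apply: monotone_convergence => //.
  - by move=> n; apply/measurable_EFinP/measurable_funTS.
  - by move=> n x Ex //=; rewrite lee_fin.
  - by move=> x Ex a b ab; rewrite lee_fin; exact/lefP/nd_nnsfun_approx.
have gfh x : (pi @^-1` E) x ->
    (fun n => (g n (pi x))%:E * (h x)%:E)%E @ \oo --> (f (pi x) * h x)%:E.
  by move=> Ex; rewrite EFinM; apply: cvgeZr => //; exact: gf.
have -> : (\int[mu]_(x in pi @^-1` E) (f (pi x) * h x)%:E =
    lim (\int[mu]_(x in pi @^-1` E) ((g n (pi x))%:E * (h x)%:E) @[n --> \oo]))%E.
  under eq_integral => x /[!inE] Ex do rewrite -(cvg_lim _ (gfh x Ex))//.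
  apply: monotone_convergence => //.
  - exact: mpre.
  - move=> n; apply/emeasurable_funM; apply/measurable_EFinP/measurable_funTS => //.
    by apply: (measurableT_comp _ mpi).
  - by move=> n x Ex //=; rewrite mule_ge0 ?lee_fin.
  - move=> x Ex a b ab; rewrite lee_wpmul2r ?lee_fin//.
    exact/lefP/nd_nnsfun_approx.
by under eq_fun do rewrite density_measure_nnsfun//.
Qed.

End density_measure.

Section density_charge.
Variables (f : T1 -> R) (intf : mu.-integrable setT (EFin \o f)).

Definition density_charge of measurable_fun setT pi & mu.-integrable setT (EFin \o f) :=
  fun A : set T2 => (\int[mu]_(x in pi @^-1` A) (f x)%:E)%E.

Local Notation nu := (density_charge mpi intf).

Let nu0 : nu set0 = 0%E.
Proof. by rewrite /density_charge preimage_set0 integral_set0. Qed.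

Let nu_fin : fin_num_fun nu.
Proof.
move=> A mA; apply: integrable_fin_num; first exact: mpre.
by apply: integrableS intf => //; exact: mpre.
Qed.

Let nu_sigma : semi_sigma_additive nu.
Proof.
move=> F mF tF mUF; rewrite /density_charge preimage_bigcup.
have H := @charge_semi_sigma_additive _ _ _ (induced_charge intf)
  (fun n => pi @^-1` F n).
apply: H; [by move=> n; exact: mpre|exact: tpre|].
by rewrite -preimage_bigcup; exact: mpre.
Qed.

HB.instance Definition _ := isCharge.Build _ _ _ nu nu0 nu_fin nu_sigma.

End density_charge.
End density.

(** * Integrals of bounded functions against signed densities *)

Lemma bounded_integrable d (T : measurableType d) (R : realType)
    (mu : {measure set T -> \bar R}) (D : set T) (phi : T -> R) (M : R) :
  measurable D -> (mu D < +oo)%E -> measurable_fun D phi ->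
  (forall x, D x -> `|phi x| <= M) -> mu.-integrable D (EFin \o phi).
Proof.
move=> mD Dfin mphi phiM.
apply: (le_integrable mD _ _ (integrable_cst_fin mD Dfin M)).
  exact/measurable_EFinP.
by move=> x Dx; rewrite /= lee_fin (le_trans (phiM _ Dx))// ler_norm.
Qed.

Lemma sube_eq_adde {R : realDomainType} (a b c e : \bar R) :
  a \is a fin_num -> b \is a fin_num -> c \is a fin_num -> e \is a fin_num ->
  (a - b = c - e -> c + b = a + e)%E.
Proof.
move: a b c e => [a| |] [b| |] [c| |] [e| |]// _ _ _ _ [] h.
by rewrite -!EFinD; congr EFin; lra.
Qed.

Section density_integral.
Context d1 d2 (T1 : measurableType d1) (T2 : measurableType d2) (R : realType).
Variables (pi : T1 -> T2) (mpi : measurable_fun [set: T1] pi).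
Variable mu : {measure set T1 -> \bar R}.
Variables (D : set T2) (mD : measurable D) (phi : T2 -> R) (M : R).
Hypotheses (mphi : measurable_fun D phi) (phiM : forall x, D x -> `|phi x| <= M).

Let mpreD : measurable (pi @^-1` D).
Proof. by rewrite -[X in measurable X]setTI; exact: mpi. Qed.

Let mphipi : measurable_fun (pi @^-1` D) (phi \o pi).
Proof.
apply: (measurable_comp mD) => //; first by move=> _ [x Dx <-].
exact: measurable_funTS.
Qed.

Lemma Rintegral_density (h : T1 -> R) (mh : measurable_fun setT h)
    (h0 : forall x, 0 <= h x) : mu.-integrable setT (EFin \o h) ->
  \int[density_measure mu mpi mh h0]_(x in D) phi x =
  \int[mu]_(x in pi @^-1` D) (phi (pi x) * h x).
Proof.
move=> ih; have ihD : mu.-integrable (pi @^-1` D) (EFin \o h).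
  exact: integrableS ih.
set m := density_measure _ _ _ _.
have mfin : (m D < +oo)%E.
  by rewrite ltey_eq (integrable_fin_num mpreD ihD).
have ge0 (f : T2 -> R) : measurable_fun D f -> (forall x, D x -> 0 <= f x) ->
    \int[m]_(x in D) f x = \int[mu]_(x in pi @^-1` D) (f (pi x) * h x).
  by move=> mf f0; rewrite /Rintegral ge0_integral_density.
have Mphi x : D x -> `|phi x| <= `|M|.
  by move=> /phiM /le_trans; apply; exact: ler_norm.
have mcst : measurable_fun D (fun=> `|M|) by exact: measurable_cst.
have mD1 : measurable_fun D (fun x => phi x + `|M|) by exact: measurable_funD.
have i1 : m.-integrable D (EFin \o phi).
  exact: bounded_integrable phiM.
have i2 : m.-integrable D (EFin \o (fun=> `|M|)) by exact: integrable_cst_fin.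
have i3 : mu.-integrable (pi @^-1` D) (EFin \o (fun x => phi (pi x) * h x)).
  by apply: (@bounded_mul_integrable _ _ _ _ _ _ (phi \o pi) _ M) => // x; exact: phiM.
have i4 : mu.-integrable (pi @^-1` D) (EFin \o (fun x => `|M| * h x)).
  exact: (integrableZl mpreD `|M| ihD).
(* Shifting by [|M|] reduces to nonnegative integrands; the contribution of the constant cancels
   afterwards. *)
have := ge0 (fun x => phi x + `|M|) mD1; rewrite RintegralD//.
rewrite (ge0 (fun=> `|M|))// => H.
apply: (@addIr _ (\int[mu]_(x in pi @^-1` D) (`|M| * h x))).
rewrite H; last first.
  by move=> x /Mphi; rewrite ler_norml => /andP[]; lra.
rewrite -RintegralD//; apply: eq_Rintegral => x _; ring.
Qed.

(* If [jp - jn] is the Jordan decomposition of the charge with density [f], then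
   [jp + f^- mu = f^+ mu + jn] as measures, for any choice of the Hahn sets. *)
Lemma charge_integral_density (f : T1 -> R)
    (intf : mu.-integrable setT (EFin \o f)) :
  charge_integral (density_charge mpi intf) D phi =
  \int[mu]_(x in pi @^-1` D) (phi (pi x) * f x).
Proof.
have mf : measurable_fun setT f by exact/measurable_EFinP/(measurable_int mu intf).
have mfp : measurable_fun setT (f^\+)%R by exact: measurable_funrpos.
have mfn : measurable_fun setT (f^\-)%R by exact: measurable_funrneg.
have fE x : (f^\+)%R x - (f^\-)%R x = f x by rewrite -[in RHS](funrposBneg f).
have fp0 x : 0 <= (f^\+)%R x by exact: funrpos_ge0.
have fn0 x : 0 <= (f^\-)%R x by exact: funrneg_ge0.
have ip : mu.-integrable setT (EFin \o (f^\+)%R) by exact: integrable_funrpos.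
have im : mu.-integrable setT (EFin \o (f^\-)%R) by exact: integrable_funrneg.
rewrite /charge_integral; set nuPN := svalP _.
set jp := jordan_pos nuPN; set jn := jordan_neg nuPN.
pose mp := density_measure mu mpi mfp fp0.
pose mn := density_measure mu mpi mfn fn0.
have mpre A : measurable A -> measurable (pi @^-1` A).
  by move=> mA; rewrite -[X in measurable X]setTI; exact: mpi.
have iS (k : T1 -> R) A : measurable A -> mu.-integrable setT (EFin \o k) ->
    mu.-integrable (pi @^-1` A) (EFin \o k).
  by move=> mA; exact: (integrableS measurableT (mpre _ mA) (@subsetT _ _)).
have mpfin A : measurable A -> mp A \is a fin_num.
  by move=> mA; apply: (integrable_fin_num (mpre _ mA)); exact: iS ip.
have mnfin A : measurable A -> mn A \is a fin_num.
  by move=> mA; apply: (integrable_fin_num (mpre _ mA)); exact: iS im.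
have E A : measurable A -> measure_add jp mn A = measure_add mp jn A.
  move=> mA; rewrite !measure_addE.
  have : density_charge mpi intf A = (jp A - jn A)%E.
    by rewrite (jordan_decomp nuPN mA) /cadd/= /cscale mulN1e.
  have : density_charge mpi intf A = (mp A - mn A)%E.
    transitivity (\int[mu]_(x in pi @^-1` A) (((f^\+)%R x)%:E - ((f^\-)%R x)%:E))%E.
      by apply: eq_integral => x _; rewrite -EFinB fE.
    rewrite integralB_EFin//; [exact: mpre|exact: iS ip|].
    exact: iS im.
  move=> ->.
  apply: sube_eq_adde; [exact: mpfin|exact: mnfin| |]; exact: fin_num_measure.
have jpfin := fin_num_measure jp _ mD; have jnfin := fin_num_measure jn _ mD.
have ijp : jp.-integrable D (EFin \o phi).
  by apply: bounded_integrable phiM => //; rewrite ltey_eq jpfin.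
have ijn : jn.-integrable D (EFin \o phi).
  by apply: bounded_integrable phiM => //; rewrite ltey_eq jnfin.
have imp : mp.-integrable D (EFin \o phi).
  by apply: bounded_integrable phiM => //; rewrite ltey_eq mpfin.
have imn : mn.-integrable D (EFin \o phi).
  by apply: bounded_integrable phiM => //; rewrite ltey_eq mnfin.
have mphiE : measurable_fun D (EFin \o phi) by exact/measurable_EFinP.
have : \int[jp]_(x in D) phi x + \int[mn]_(x in D) phi x =
       \int[mp]_(x in D) phi x + \int[jn]_(x in D) phi x.
  rewrite /Rintegral -!fineD; [|exact: integrable_fin_num..].
  rewrite -!integral_measure_add//; congr fine.
  by apply: eq_measure_integral => A mA _; exact: E.
rewrite !Rintegral_density//.
have i1 : mu.-integrable (pi @^-1` D) (EFin \o (fun x => phi (pi x) * (f^\+)%R x)).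
  by apply: (@bounded_mul_integrable _ _ _ _ _ _ (phi \o pi) _ M) => //;
    [by move=> x; exact: phiM|exact: iS ip].
have i2 : mu.-integrable (pi @^-1` D) (EFin \o (fun x => phi (pi x) * (f^\-)%R x)).
  by apply: (@bounded_mul_integrable _ _ _ _ _ _ (phi \o pi) _ M) => //;
    [by move=> x; exact: phiM|exact: iS im].
have -> : \int[mu]_(x in pi @^-1` D) (phi (pi x) * f x) =
  \int[mu]_(x in pi @^-1` D) (phi (pi x) * (f^\+)%R x) -
  \int[mu]_(x in pi @^-1` D) (phi (pi x) * (f^\-)%R x).
  rewrite -RintegralB//; apply: eq_Rintegral => x _.
  by rewrite -mulrBr fE.
by move=> H; apply/eqP; rewrite subr_eq addrAC -H addrK.
Qed.

End density_integral.

(** * Lower limits, Euclidean norms and L^1 distances *)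

(** Otherwise some tail stays above [M], and so does the lower limit. The selection [s] satisfies
    only n <= s n, which is enough to preserve limits. *)
Lemma limn_einf_lt_subseq {R : realType} (u : nat -> \bar R) (M : \bar R) :
  (limn_einf u < M)%E ->
  exists s : nat -> nat, forall n, (n <= s n)%N /\ (u (s n) < M)%E.
Proof.
move=> uM; suff /choice[s Hs] : forall n, exists k, (n <= k)%N /\ (u k < M)%E.
  by exists s.
move=> n; apply: contrapT => /forallNP nu.
move: uM; apply/negP; rewrite -leNgt limn_einf_lim.
apply: lime_ge; first exact: is_cvg_einfs.
exists n => // m /= nm; apply: le_ereal_inf_tmp => _ [k /= mk <-].
by rewrite leNgt; apply/negP => ukM; apply: (nu k); split => //; exact: leq_trans mk.
Qed.

Lemma cvg_subseq_ge {T : topologicalType} (s : nat -> nat) (u : nat -> T) (l : T) :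
  (forall n, (n <= s n)%N) -> u @ \oo --> l -> (fun n => u (s n)) @ \oo --> l.
Proof.
move=> ns; apply: cvg_comp => A [N _ NA]; exists N => // n /= Nn.
by apply: NA => /=; exact: leq_trans (ns n).
Qed.

(** Reduces a comparison of infima, possibly infinite, to real energy bounds. *)
Lemma le_real_gt {R : realType} (x y : \bar R) :
  (forall M : R, (x < M%:E)%E -> (y <= M%:E)%E) -> (y <= x)%E.
Proof.
case: x => [r| |] H; [|by rewrite leey|].
  by apply/lee_addgt0Pr => e e0; apply: H; rewrite lte_fin ltrDl.
case: y H => [r| |] H //.
- by have := H (r - 1)%R (ltNyr _); rewrite lee_fin => h; exfalso; lra.
- by have := H 0 (ltNyr _).
Qed.

(* Unlike [ge0_le_integral], this requires no measurability; that of
   [x |-> W x (grad Omega u x)] would be another Caratheodory argument. *)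
Lemma ge0_le_integral_lower d (T : measurableType d) (R : realType)
    (mu : {measure set T -> \bar R}) (D : set T) (f1 f2 : T -> \bar R) :
  (forall x, D x -> (0 <= f1 x)%E) -> (forall x, D x -> (f1 x <= f2 x)%E) ->
  (\int[mu]_(x in D) f1 x <= \int[mu]_(x in D) f2 x)%E.
Proof.
move=> f10 f12; rewrite !(integral_mkcond D).
have h12 x : ((f1 \_ D) x <= (f2 \_ D) x)%E by exact: lee_restrict.
have h10 x : (0 <= (f1 \_ D) x)%E by exact: erestrict_ge0.
rewrite !ge0_integralTE//; last by move=> x; exact: le_trans (h12 x).
by apply: ereal_sup_le => _ [h /= hf <-]; exists h => //= x; exact: le_trans (h12 x).
Qed.

Section enorm.
Context {R : realType} {m n : nat}.
Implicit Types A B : 'M[R]_(m, n).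

Lemma enorm_ge0 A : 0 <= enorm A. Proof. exact: sqrtr_ge0. Qed.

Let sumsq_ge0 A : 0 <= \sum_i \sum_j A i j ^+ 2.
Proof. by apply: sumr_ge0 => i _; apply: sumr_ge0 => j _; exact: sqr_ge0. Qed.

Lemma enorm_sqr A : enorm A ^+ 2 = \sum_i \sum_j A i j ^+ 2.
Proof. by rewrite sqr_sqrtr. Qed.

Lemma enormN A : enorm (- A) = enorm A.
Proof.
by congr Num.sqrt; apply: eq_bigr => i _; apply: eq_bigr => j _; rewrite mxE sqrrN.
Qed.

(* The factor [2] makes Cauchy-Schwarz unnecessary and is harmless for limits. *)
Lemma enormD A B : enorm (A + B) <= 2 * (enorm A + enorm B).
Proof.
rewrite -(@ler_pXn2r _ 2)// ?nnegrE ?mulr_ge0 ?addr_ge0 ?enorm_ge0//.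
apply: (@le_trans _ _ (2 * (enorm A ^+ 2 + enorm B ^+ 2))).
  rewrite !enorm_sqr -big_split/= mulr_sumr; apply: ler_sum => i _.
  rewrite -big_split/= mulr_sumr; apply: ler_sum => j _; rewrite mxE.
  by have := sqr_ge0 (A i j - B i j); nra.
by have := enorm_ge0 A; have := enorm_ge0 B; nra.
Qed.

Lemma le_enorm A i j : `|A i j| <= enorm A.
Proof.
rewrite -(@ler_pXn2r _ 2)// ?nnegrE ?enorm_ge0// enorm_sqr real_normK ?num_real//.
rewrite (bigD1 i)//= (bigD1 j)//= -addrA lerDl addr_ge0//.
  by apply: sumr_ge0 => k _; exact: sqr_ge0.
by apply: sumr_ge0 => k _; apply: sumr_ge0 => l _; exact: sqr_ge0.
Qed.

Lemma enorm_le A t : 0 <= t -> (forall i j, `|A i j| <= t) ->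
  enorm A <= (m * n)%:R * t.
Proof.
move=> t0 At; rewrite -(@ler_pXn2r _ 2)// ?nnegrE ?mulr_ge0 ?enorm_ge0//.
rewrite enorm_sqr (@le_trans _ _ ((m * n)%:R * t ^+ 2))//.
  rewrite (@le_trans _ _ (\sum_(i < m) \sum_(j < n) t ^+ 2))//.
    apply: ler_sum => i _; apply: ler_sum => j _.
    by rewrite -real_normK ?num_real// lerXn2r ?nnegrE.
  by rewrite !sumr_const !card_ord -mulrnA (mulnC n m) mulr_natl.
rewrite exprMn ler_wpM2r ?sqr_ge0// -natrX ler_nat.
by case: (m * n)%N => // k; rewrite leq_pmulr.
Qed.

(** With S the sum on the right, every entry is at most S^(1/p); [enorm_le] with t = S^(1/p) gives
    the constant. *)
Lemma enorm_powR_le A (p : R) : 1 <= p ->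
  enorm A `^ p <= (m * n)%:R `^ p * \sum_i \sum_j `|A i j| `^ p.
Proof.
move=> p1; have p0 : 0 < p by lra.
set S := \sum_i _; have S0 : 0 <= S.
  by apply: sumr_ge0 => i _; apply: sumr_ge0 => j _; exact: powR_ge0.
have pK t : 0 <= t -> (t `^ p^-1) `^ p = t.
  by move=> t0; rewrite -powRrM mulVf ?lt0r_neq0// powRr1.
rewrite -[X in _ <= _ * X]pK// -powRM ?powR_ge0//.
rewrite ge0_ler_powR ?nnegrE ?mulr_ge0 ?powR_ge0 ?enorm_ge0 ?(ltW p0)//.
apply: enorm_le => [|i j]; first exact: powR_ge0.
rewrite -[leLHS]pK// -!powRrM mulrC !powRrM.
rewrite ge0_ler_powR ?nnegrE ?powR_ge0 ?invr_ge0 ?(ltW p0)//.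
rewrite /S (bigD1 i)//= (bigD1 j)//= -addrA lerDl addr_ge0//.
  by apply: sumr_ge0 => k _; exact: powR_ge0.
by apply: sumr_ge0 => k _; apply: sumr_ge0 => l _; exact: powR_ge0.
Qed.

Lemma measurable_enorm d (T : measurableType d) (D : set T) (G : T -> 'M[R]_(m, n)) :
  (forall i j, measurable_fun D (fun x => G x i j)) ->
  measurable_fun D (fun x => enorm (G x)).
Proof.
move=> mG; apply: (measurableT_comp (continuous_measurable_fun (@sqrt_continuous R))).
apply: measurable_sum => i; apply: measurable_sum => j.
exact: measurable_funX.
Qed.

End enorm.

Lemma cvge0_mul2D (R : realType) (a b : nat -> \bar R) :
  a @ \oo --> 0%E -> b @ \oo --> 0%E ->
  (fun k => 2%:E * (a k + b k))%E @ \oo --> 0%E.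
Proof.
move=> a0 b0.
have ab0 := @cvgeD _ _ eventually_filter _ _ _ _ _ (isT : (0 : \bar R) +? 0)%E a0 b0.
have := cvgeZl (isT : (2%:E : \bar R) \is a fin_num)%E ab0.
by rewrite adde0 mule0.
Qed.

Section L1_distance.
Context d (T : measurableType d) (R : realType) (m n : nat).
Variables (mu : {measure set T -> \bar R}) (D : set T).
Hypothesis mD : measurable D.
Implicit Types f g h : T -> 'M[R]_(m, n).

Definition L1dist f g : \bar R :=
  (\int[mu]_(x in D) (enorm (f x - g x))%:E)%E.

Definition mxmeasurable f := forall i j, measurable_fun D (fun x => f x i j).

Lemma L1dist_sym f g : L1dist f g = L1dist g f.
Proof. by apply: eq_integral => x _; rewrite -enormN opprB. Qed.

Lemma L1dist_ge0 f g : (0 <= L1dist f g)%E.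
Proof. by apply: integral_ge0 => x _; rewrite lee_fin enorm_ge0. Qed.

Lemma mxmeasurableB f g : mxmeasurable f -> mxmeasurable g ->
  measurable_fun D (fun x => (enorm (f x - g x))%:E).
Proof.
move=> mf mg; apply/measurable_EFinP; apply: measurable_enorm => i j.
under eq_fun do rewrite !mxE.
exact: measurable_funB.
Qed.

Lemma L1dist_triangle f g h : mxmeasurable f -> mxmeasurable g ->
  mxmeasurable h -> (L1dist f h <= 2%:E * (L1dist f g + L1dist g h))%E.
Proof.
move=> mf mg mh.
have m1 := mxmeasurableB mf mg; have m2 := mxmeasurableB mg mh.
rewrite /L1dist -ge0_integralD//; [|by move=> x _; rewrite lee_fin enorm_ge0..].
rewrite -ge0_integralZl//; first last.
- by move=> x _; rewrite adde_ge0// lee_fin enorm_ge0.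
- exact: emeasurable_funD.
apply: ge0_le_integral_lower => x _; first by rewrite lee_fin enorm_ge0.
rewrite -EFinD -EFinM lee_fin (_ : f x - h x = (f x - g x) + (g x - h x)).
  exact: enormD.
by rewrite addrA subrK.
Qed.

Lemma cvg_L1_unique (u : nat -> T -> 'M[R]_(m, n)) f g :
  (forall k, mxmeasurable (u k)) -> mxmeasurable f -> mxmeasurable g ->
  (fun k => L1dist (u k) f) @ \oo --> 0%E ->
  (fun k => L1dist (u k) g) @ \oo --> 0%E -> L1dist f g = 0%E.
Proof.
move=> mu_ mf mg uf ug; apply/eqP; rewrite eq_le L1dist_ge0 andbT.
have cv := cvge0_mul2D uf ug.
rewrite -(cvg_lim _ cv)//; apply: lime_ge; first by apply/cvg_ex; exists 0%E.
by apply: nearW => k; rewrite (L1dist_sym (u k) f); exact: L1dist_triangle.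
Qed.

Lemma cvg_L1_eq (h k : nat -> T -> 'M[R]_(m, n)) g :
  (forall n, mxmeasurable (h n)) -> (forall n, mxmeasurable (k n)) ->
  mxmeasurable g -> (forall n, L1dist (h n) (k n) = 0%E) ->
  (fun n => L1dist (h n) g) @ \oo --> 0%E ->
  (fun n => L1dist (k n) g) @ \oo --> 0%E.
Proof.
move=> mh mk mg hk hg.
have cv : (fun n => 2%:E * (L1dist (h n) g + 0))%E @ \oo --> 0%E.
  exact: (cvge0_mul2D hg (cvg_cst _)).
apply: (squeeze_cvge _ (cvg_cst 0%E) cv); apply: nearW => l.
rewrite [X in (X <= _ <= _)%E]/= L1dist_ge0/=.
apply: le_trans (L1dist_triangle (mk l) (mh l) mg) _.
by rewrite L1dist_sym hk addeC.
Qed.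

End L1_distance.

(** The lower bound is truncated to the measurable nonnegative function [f], which lies below [w]
    off a null set; then a <= c^-1 (f + c^-1) is integrated. *)
Lemma coercive_integral_le d (T : measurableType d) (R : realType)
    (mu : {measure set T -> \bar R}) (D : set T) (c K : R) (a w : T -> R) :
  measurable D -> (mu D < +oo)%E -> 0 < c -> measurable_fun D a ->
  (forall x, 0 <= a x) -> (forall x, D x -> 0 <= w x) ->
  {ae mu, forall x, D x -> c * a x - c^-1 <= w x} ->
  (\int[mu]_(x in D) (w x)%:E <= K%:E)%E ->
  (\int[mu]_(x in D) (a x)%:E <= (c^-1 * (K + c^-1 * fine (mu D)))%:E)%E.
Proof.
move=> mD Dfin c0 ma a0 w0 [Z [mZ Z0 HZ]] wK.
pose f x := Num.max 0 (c * a x - c^-1).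
have mf : measurable_fun D f.
  apply: measurable_maxr => //; apply: measurable_funB => //.
  exact: measurable_funM.
have f0 x : 0 <= f x by rewrite /f le_max lexx.
have mfE : measurable_fun D (EFin \o f) by exact/measurable_EFinP.
have fK : (\int[mu]_(x in D) (f x)%:E <= K%:E)%E.
  apply: le_trans wK.
  (* As f <= w may fail on [Z], the integral of [f] is cut down to the complement of [Z] in [D];
     returning to [D] is harmless since w >= 0. *)
  rewrite (ge0_negligible_integral mZ _ _ _ Z0)//; last first.
    by move=> x _; rewrite lee_fin.
  rewrite [leLHS]integral_mkcond [leRHS]integral_mkcond.
  apply: ge0_le_integral_lower => x _.
    by apply: erestrict_ge0 => y [Dy _]; rewrite lee_fin.
  rewrite /patch; case: ifPn => [|_]; last first.
    by case: ifPn => // /[!inE] Dx; rewrite lee_fin w0.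
  rewrite inE => -[Dx nZx]; rewrite mem_set// lee_fin /f ge_max w0//=.
  have : (~` Z) x := nZx.
  by move=> /(subsetCl HZ) /= ->.
have ci : 0 <= c^-1 by rewrite invr_ge0 ltW.
apply: (@le_trans _ _ (\int[mu]_(x in D)
   ((c^-1)%:E * ((f x)%:E + (c^-1)%:E)))%E).
  apply: ge0_le_integral_lower => x Dx; first by rewrite lee_fin.
  rewrite -EFinD -EFinM lee_fin ler_pdivlMl//.
  by rewrite -lerBlDr /f le_max lexx orbT.
rewrite ge0_integralZl//; first last.
- by move=> x _; rewrite adde_ge0// lee_fin.
- by apply: emeasurable_funD.
rewrite EFinM lee_wpmul2l ?lee_fin//.
rewrite ge0_integralD//; last by move=> x _; rewrite lee_fin.
rewrite EFinD leeD// integral_cst// EFinM fineK//.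
by rewrite ge0_fin_numE.
Qed.

(** * Energies and relaxation *)

Section energies.
Context {R : realType} {N d : nat}.
Variables (Omega : set 'rV[R]_N).
Hypotheses (oO : open Omega) (bO : bounded_set Omega).
Notation X := 'rV[R]_N.
Notation Y := 'rV[R]_d.
Notation M := 'M[R]_(d, N).

Let mO : measurable (Omega : set (lebT R N)).
Proof. exact: open_measurable_leb. Qed.

Let mOb : measurable (Omega : set (borT R N)).
Proof. exact: sub_sigma_algebra. Qed.

Let fO : (leb R N Omega < +oo)%E.
Proof. exact: leb_bounded_lty. Qed.

Lemma SBV_Lp1 (u : X -> Y) : SBV Omega u -> Lp Omega 1 u.
Proof. by case=> A []. Qed.

Lemma SBV_grad (u : X -> Y) : SBV Omega u ->
  sbv_decomposition Omega u (grad Omega u).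
Proof. by move=> [A uA]; apply: (xgetPex (fun=> 0)); exists A. Qed.

Lemma Lp_integrable (p : R) (G : X -> M) i j : 1 <= p -> Lp Omega p G ->
  (leb R N).-integrable Omega (fun x => (G x i j)%:E).
Proof.
move=> p1 [mG iG].
have ip : (leb R N).-integrable Omega (fun x => (enorm (G x) `^ p)%:E).
  apply/integrableP; split.
    apply/measurable_EFinP; apply: (measurableT_comp (measurable_powR p)).
    exact: measurable_enorm.
  by under eq_integral do rewrite gee0_abs ?lee_fin ?powR_ge0//.
apply: (le_integrable mO _ _ (integrableD mO (integrable_cst_fin mO fO 1) ip)).
  exact/measurable_EFinP.
move=> x Ox; rewrite /= lee_fin [leRHS]ger0_norm ?addr_ge0 ?powR_ge0//.
apply: le_trans (le_enorm _ _ _) _.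
exact: le1_powR p1 (enorm_ge0 _).
Qed.

(** Provides the inner limits that [cvgH2] requires as measures: each entry, extended by 0 outside
    [Omega], is the density of a Borel charge. *)
Lemma Lp_mxmeasure (p : R) (G : X -> M) : 1 <= p -> Lp Omega p G ->
  exists mu : mxmeasure (R := R) (N := N) d N,
    forall phi, C0 Omega phi -> pair_mes Omega mu phi = pair_fun Omega G phi.
Proof.
move=> p1 GLp.
have iG i j : (leb R N).-integrable [set: lebT R N]
    (EFin \o ((fun x => G x i j) \_ Omega)).
  rewrite -restrict_EFin; apply/(integrable_mkcond _ mO).1.
  exact: Lp_integrable GLp.
exists (fun i j => density_charge (@measurable_id_leb_bor R N) (iG i j)).
move=> phi Cphi; have [K phiK] := C0_bounded Cphi.
have mphi := C0_measurable oO Cphi.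
apply/matrixP => i j; rewrite !mxE.
rewrite (charge_integral_density _ mOb mphi phiK).
apply: eq_Rintegral => x; rewrite preimage_id => Ox.
by rewrite /patch Ox.
Qed.

Lemma cvg_pair_entry (u : nat -> X -> M) (T0 : M) phi i j :
  (fun k => pair_fun Omega (u k) phi) @ \oo --> T0 ->
  (fun k => \int[leb R N]_(x in Omega) (phi x * u k x i j)) @ \oo --> T0 i j.
Proof.
move=> h; have := cvg_comp _ _ h (@coord_continuous R d N i j T0).
by rewrite /comp; under eq_fun do rewrite mxE.
Qed.

Section energy.
Variables (p : R) (p1 : 1 <= p).
Variables (W : X -> M -> R) (psi : X -> Y -> X -> R).
Hypothesis hED : ED Omega p W psi.

Lemma surface_energy_ge0 (u : X -> Y) :
  (0 <= \int[haus R N N.-1]_(x in jump_set Omega u)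
     (psi x (jump u x) (jump_normal u x))%:E)%E.
Proof.
apply: integral_ge0 => x [Ox [t jt]]; rewrite lee_fin.
apply: (ED_psi_ge0 hED) => //; rewrite /usphere /jump_normal/=.
(* On the jump set [xget] returns a genuine triple, not its default with zero normal, so the normal
   is a unit vector. *)
have : is_jump u x (jump_triple u x) by apply: (xgetPex (0, 0, 0)); exists t.
by case: (jump_triple u x) => -[a b] nu [].
Qed.

(** The surface term is nonnegative, so [K] bounds the bulk term alone; [C] depends on [K] but not
    on [u]. *)
Lemma energy_bound_Lp (K : R) : exists C : R, forall u, SBV Omega u ->
  (energy Omega W psi u <= K%:E)%E ->
  (\int[leb R N]_(x in Omega) (enorm (grad Omega u x) `^ p)%:E <= C%:E)%E.
Proof.
have [c c0 cW] := ED_W_coercive hED.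
exists (c^-1 * (K + c^-1 * fine (leb R N Omega))) => u /SBV_grad[_ [mA _] _ _] uK.
apply: (@coercive_integral_le _ (lebT R N) R (leb R N) Omega c K
  (fun x => enorm (grad Omega u x) `^ p) (fun x => W x (grad Omega u x))
  mO fO c0).
- apply: (measurableT_comp (measurable_powR p)); exact: measurable_enorm.
- by move=> x; exact: powR_ge0.
- by move=> x Ox; exact: (ED_W_ge0 hED).
- case: cW => Z [mZ Z0 HZ]; exists Z; split=> // x /= nx; apply: HZ => /= h.
  by apply: nx => Ox; exact: h.
- apply: le_trans uK; exact: leeDl (surface_energy_ge0 u).
Qed.

End energy.
End energies.

Lemma entries_Lp d (T : measurableType d) (R : realType) (m n : nat)
    (mu : {measure set T -> \bar R}) (D : set T) (p C : R)
    (G : T -> 'M[R]_(m, n)) : measurable D -> 1 <= p ->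
  (forall i j, Lp_ball mu D p C (fun x => G x i j)) ->
  (forall i j, measurable_fun D (fun x => G x i j)) /\
  (\int[mu]_(x in D) (enorm (G x) `^ p)%:E < +oo)%E.
Proof.
move=> mD p1 GC; split=> [i j|]; first by have [] := GC i j.
pose S x := (\sum_i \sum_j (`|G x i j| `^ p)%:E)%E.
have iS : mu.-integrable D S.
  apply: integrable_sum => // i _; apply: integrable_sum => // j _.
  exact: integrable_normr_powR (GC i j).
have iKS := integrableZl mD ((m * n)%:R `^ p) iS.
apply: (@le_lt_trans _ _ (\int[mu]_(x in D) (((m * n)%:R `^ p)%:E * S x))%E).
  apply: ge0_le_integral_lower => x Dx; first by rewrite lee_fin powR_ge0.
  have -> : S x = (\sum_i \sum_j `|G x i j| `^ p)%:E.
    by rewrite -sumEFin; apply: eq_bigr => i _; rewrite -sumEFin.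
  by rewrite -EFinM lee_fin enorm_powR_le.
by rewrite -ge0_fin_numE ?(integrable_fin_num mD iKS)//;
   apply: integral_ge0 => x _; rewrite mule_ge0 ?lee_fin ?powR_ge0//;
   apply: sume_ge0 => i _; apply: sume_ge0 => j _; rewrite lee_fin powR_ge0.
Qed.

Lemma le_entry_Lp_ball d (T : measurableType d) (R : realType) (m n : nat)
    (mu : {measure set T -> \bar R}) (D : set T) (p C : R)
    (G : T -> 'M[R]_(m, n)) i j : 0 <= p ->
  (forall i j, measurable_fun D (fun x => G x i j)) ->
  (\int[mu]_(x in D) (enorm (G x) `^ p)%:E <= C%:E)%E ->
  Lp_ball mu D p C (fun x => G x i j).
Proof.
move=> p0 mG GC; split; first exact: mG.
apply: le_trans GC; apply: ge0_le_integral_lower => x Dx.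
  by rewrite lee_fin powR_ge0.
by rewrite lee_fin ge0_ler_powR ?nnegrE ?enorm_ge0// le_enorm.
Qed.

(** * The two inequalities *)

Section relaxation.
Context {R : realType} {N d : nat}.
Variables (Omega : set 'rV[R]_N).
Hypotheses (oO : open Omega) (bO : bounded_set Omega).
Notation X := 'rV[R]_N.
Notation Y := 'rV[R]_d.
Notation M := 'M[R]_(d, N).
Variables (p : R) (p1 : 1 <= p).
Variables (W : X -> M -> R) (psi : X -> Y -> X -> R).
Hypothesis hED : ED Omega p W psi.

Let mO : measurable (Omega : set (lebT R N)).
Proof. exact: open_measurable_leb. Qed.

Let mOb : measurable (Omega : set (borT R N)).
Proof. exact: sub_sigma_algebra. Qed.

Let fO : (leb R N Omega < +oo)%E.
Proof. exact: leb_bounded_lty. Qed.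

(** Applied entry by entry, [weak_Lp_limit] yields a function fixed before the test function; as the
    whole sequence converges against every [phi], that function represents the limit. *)
Lemma wstar_limit_Lp (u : nat -> X -> Y) (K : R) (T0 : (X -> R) -> M) : 1 < p ->
  (forall n, SBV Omega (u n)) ->
  (forall n, energy Omega W psi (u n) <= K%:E)%E ->
  cvg_wstar Omega (fun k => pair_fun Omega (grad Omega (u k))) T0 ->
  exists2 G : X -> M, Lp Omega p G &
    forall phi, C0 Omega phi -> T0 phi = pair_fun Omega G phi.
Proof.
move=> lt1p uS uK uT; have [C HC] := energy_bound_Lp oO bO hED K.
have gC i j n : Lp_ball (leb R N) Omega p C (fun x => grad Omega (u n) x i j).
  have [_ [mG _] _ _] := SBV_grad (uS n).
  by apply: le_entry_Lp_ball => //; [lra|exact: HC].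
have /choice[G HG] : forall ij : 'I_d * 'I_N, exists h : X -> R,
    Lp_ball (leb R N) Omega p C h /\
    forall phi, C0 Omega phi ->
      \int[leb R N]_(x in Omega) (phi x * h x) = T0 phi ij.1 ij.2.
  move=> [i j]; have [h hC hphi] := weak_Lp_limit mO fO lt1p (gC i j).
  exists h; split => // phi Cphi; have [B phiB] := C0_bounded Cphi.
  apply: hphi phiB _.
    by apply: measurable_fun_bor_leb => //; exact: C0_measurable.
  exact: cvg_pair_entry (uT _ Cphi).
have GC i j : Lp_ball (leb R N) Omega p C
    (fun x => (\matrix_(i, j) G (i, j) x : M) i j).
  by under eq_fun do rewrite mxE; exact: (HG (i, j)).1.
exists (fun x => \matrix_(i, j) G (i, j) x); first exact: (entries_Lp mO p1 GC).
move=> phi Cphi; apply/matrixP => i j; rewrite mxE -((HG (i, j)).2 _ Cphi).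
by apply: eq_Rintegral => x _; rewrite mxE.
Qed.

Lemma I2_le_I2t (g : X -> Y) (G1 G2 : X -> M) :
  (I2 Omega W psi p g G1 G2 <= I2t Omega W psi p g G1 G2)%E.
Proof.
apply: le_ereal_inf_tmp => _ [s [sSD sH sG] <-].
apply: le_real_gt => K /limn_einf_lt_subseq[r Hr].
(* Each retained [I1] is below [K], hence so is the lower limit along some competitor; the common
   bound [K] takes the place of errors tending to 0. *)
have /choice[u Hu] : forall n, exists v : nat -> X -> Y,
    [/\ forall k, SBV Omega (v k), cvgH1 Omega v (s.1 (r n)) (s.2 (r n)) &
      (limn_einf (fun k => energy Omega W psi (v k)) < K%:E)%E].
  by move=> n; have [_ /ereal_inf_lt[_ [v [vS vH] <-] vK]] := Hr n; exists v.
have /choice[mu Hmu] : forall n, exists mu : mxmeasure (R := R) (N := N) d N,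
    forall phi, C0 Omega phi ->
      pair_mes Omega mu phi = pair_fun Omega (s.2 (r n)) phi.
  by move=> n; have [_ sL] := sSD (r n); exact: Lp_mxmeasure sL.
have rn n : (n <= r n)%N := (Hr n).1.
apply: (@le_trans _ _ (limn_einf (fun n => limn_einf (fun k => energy Omega W psi (u n k))))).
  apply: ereal_inf_lbound; exists u; last by [].
  split.
    by move=> n k; have [] := Hu n.
  (* For p = 1 the density demanded of each inner limit is [s.2 (r n)] itself. *)
  exists mu; last first.
    move=> pe n; have [_ sL] := sSD (r n); rewrite pe in sL.
    by exists (s.2 (r n)) => //; exact: Hmu.
  split.
  - exists (fun n => s.1 (r n)); last exact: cvg_subseq_ge rn sH.1.
    move=> n; have [sS _] := sSD (r n); split; first exact: SBV_Lp1.
    by have [_ [uL _] _] := Hu n.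
  - exists (fun n => s.1 (r n)).
      by move=> n; have [sS _] := sSD (r n); have [_ [uL _] _] := Hu n.
    by move=> phi Cphi; exact: cvg_subseq_ge rn (sH.2 phi Cphi).
  - by move=> n phi Cphi; rewrite Hmu//; have [_ [_ uG] _] := Hu n; exact: uG.
  - move=> phi Cphi; rewrite (_ : (fun n => _) = fun n => pair_fun Omega (s.2 (r n)) phi).
      exact: cvg_subseq_ge rn (sG phi Cphi).
    by apply/funext => n; rewrite Hmu.
by apply: limn_einf_le => n; have [_ _ /ltW] := Hu n.
Qed.

Lemma I2t_le_I2 (g : X -> Y) (G1 G2 : X -> M) : SD2 Omega p g G1 G2 ->
  (I2t Omega W psi p g G1 G2 <= I2 Omega W psi p g G1 G2)%E.
Proof.
move=> [gS _ _]; apply: le_ereal_inf_tmp => _ [u [uS [mu uH mu1]] <-].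
have [[h hu hg] [gn gnu gnG] umu muG] := uH.
apply: le_real_gt => K /limn_einf_lt_subseq[r Hr].
have rn n : (n <= r n)%N := (Hr n).1.
have /choice[G HG] : forall n, exists G : X -> M, Lp Omega p G /\
    forall phi, C0 Omega phi -> pair_mes Omega (mu (r n)) phi = pair_fun Omega G phi.
  move=> n; move: p1; rewrite le_eqVlt => /predU1P[pe|lt1p].
    by have [G GL Gmu] := mu1 (esym pe) (r n); exists G; rewrite -pe.
  (* Energies are bounded only along [t]; the whole inner sequence converges weakly*, so its limit
     may be identified along [t]. *)
  have [_ /limn_einf_lt_subseq[t Ht]] := Hr n.
  have tn k : (k <= t k)%N := (Ht k).1.
  have uT : cvg_wstar Omega
      (fun k => pair_fun Omega (grad Omega (u (r n) (t k))))
      (pair_mes Omega (mu (r n))).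
    by move=> phi Cphi; exact: cvg_subseq_ge tn (umu (r n) phi Cphi).
  have uK k := ltW (Ht k).2.
  have [G GL Gmu] := wstar_limit_Lp lt1p (fun k => uS (r n) (t k)) uK uT.
  by exists G.
apply: (@le_trans _ _ (limn_einf (fun n => I1 Omega W psi (gn (r n)) (G n)))).
  apply: ereal_inf_lbound; exists (fun n => gn (r n), G); last by [].
  split => /=.
  - by move=> n; split; [exact: (gnu (r n)).1|exact: (HG n).1].
  - split; last by move=> phi Cphi; exact: cvg_subseq_ge rn (gnG phi Cphi).
    (* The inner L^1 limit is given twice: [h] converges to [g], while the gradients of [gn]
       converge. Both agree almost everywhere, so [gn] converges to [g] as well. *)
    have mgn n : @mxmeasurable _ (lebT R N) R 1 d Omega (gn n).
      exact: (SBV_Lp1 (gnu n).1).1.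
    have mh n : @mxmeasurable _ (lebT R N) R 1 d Omega (h n) by exact: (hu n).1.1.
    have mu_ n k : @mxmeasurable _ (lebT R N) R 1 d Omega (u n k).
      exact: (SBV_Lp1 (uS n k)).1.
    have mg : @mxmeasurable _ (lebT R N) R 1 d Omega (g) by exact: (SBV_Lp1 gS).1.
    have hgn n : L1dist (leb R N) Omega (h n) (gn n) = 0%E.
      exact: (cvg_L1_unique mO (mu_ n) (mh n) (mgn n) (hu n).2 (gnu n).2).
    exact: cvg_subseq_ge rn (cvg_L1_eq mO mh mgn mg hgn hg).
  - move=> phi Cphi.
    rewrite (_ : (fun n => _) = fun n => pair_mes Omega (mu (r n)) phi).
      exact: cvg_subseq_ge rn (muG phi Cphi).
    by apply/funext => n; rewrite (HG n).2.
apply: limn_einf_le => n; apply: le_trans (ltW (Hr n).2).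
(* The competitor is the whole inner sequence rather than the part along [t]: its lower limit is the
   quantity below [K]. *)
apply: ereal_inf_lbound; exists (u (r n)); last by [].
split; [exact: uS|split].
  exact: (gnu (r n)).2.
by move=> phi Cphi; rewrite -(HG n).2//; exact: umu.
Qed.

End relaxation.

Unset Implicit Arguments.

Theorem proposition4p1 (R : realType) (N d : nat)
    (hN : (0 < N)%N) (hd : (0 < d)%N)
    (Omega : set 'rV[R]_N)
    (hOpen : open Omega) (hBounded : bounded_set Omega)
    (hConnected : connected Omega) (hLipschitz : lipschitz_boundary Omega)
    (p : R) (hp : 1 <= p)
    (W : 'rV[R]_N -> 'M[R]_(d, N) -> R)
    (psi : 'rV[R]_N -> 'rV[R]_d -> 'rV[R]_N -> R)
    (hED : ED Omega p W psi)
    (g : 'rV[R]_N -> 'rV[R]_d) (G1 G2 : 'rV[R]_N -> 'M[R]_(d, N))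
    (hSD : SD2 Omega p g G1 G2) :
  I2 Omega W psi p g G1 G2 = I2t Omega W psi p g G1 G2.
Proof.
by apply/eqP; rewrite eq_le I2_le_I2t// I2t_le_I2.
Qed.
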